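(* Let $k$ be a field with a fixed separable closure $k^{\mathrm{sep}}$, and let $\mathbf{K}=K_{1}\times K_{2}$ be a finite étale algebra over $k$, where $K_1,K_2\subset k^{\mathrm{sep}}$ are finite separable extensions of $k$. Assume that - $K_{1}K_{2}/k$ is Galois with Galois group isomorphic to $D_{2m}$ for some integer $m\geq 1$; - $[K_{1}K_{2}:K_{i}]=2$ and $K_{i}/k$ is non-Galois for each $i\in\{1,2\}$; and - $K_{1}$ and $K_{2}$ are not conjugate to each other over $k$. Then the multinorm one torus $T_{\mathbf{K}/k}$ is stably rational over $k$.
   Context: For $n\geq 1$, $D_{n}$ is the dihedral group of order $2n$. For a finite étale $k$-algebra $\mathbf{K}$, the multinorm one torus is the algebraic $k$-torus $T_{\mathbf{K}/k}:=\mathrm{Ker}(\mathrm{N}_{\mathbf{K}/k}\colon \mathrm{Res}_{\mathbf{K}/k}\mathbb{G}_{m}\to\mathbb{G}_{m})$, where $\mathrm{Res}_{\mathbf{K}/k}$ is Weil restriction and $\mathrm{N}_{\mathbf{K}/k}$ is the norm map. An algebraic variety $X$ over $k$ is stably rational over $k$ if $X\times_k\mathbb{P}^n_k$ is birationally equivalent over $k$ to a projective space over $k$ for some $n\ge 0$. *)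

(* Defs.v *)
From HB Require Import structures.
From mathcomp Require Import all_boot all_order all_algebra all_fingroup.
From mathcomp Require Import all_solvable all_field.
From mathcomp Require Import mpoly.

Set Implicit Arguments.
Unset Strict Implicit.
Unset Printing Implicit Defensive.

Import GRing.Theory.
Local Open Scope ring_scope.

(* The affine k-scheme Spec (aff_ring / aff_ideal).  Quotient rings are never
   formed: a polynomial over the quotient is zero when all the coefficients of
   a lift lie in the ideal. *)
Record affScheme (k : fieldType) := AffScheme {
  aff_ring : comAlgType k;
  aff_ideal : aff_ring -> Prop
}.

Definition Spec_base (k : fieldType) : affScheme k :=
  @AffScheme k k^o (fun a => a = 0).

(* X * P^n is Proj of the graded ring (A/I)[y_0, ..., y_n], where
   X = Spec (A/I).  A polynomial over A stands for its class modulo I. *)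
Definition cone_ring (k : fieldType) (X : affScheme k) (n : nat) :=
  {mpoly (aff_ring X)[n.+1]}.

Definition cone_null (k : fieldType) (X : affScheme k) (n : nat)
    (G : cone_ring X n) : Prop :=
  forall m : 'X_{1.. n.+1}, aff_ideal (G@_m).

(* Density of the principal open subset D_+(F) of X * P^n: F is not a
   zero divisor in (A/I)[y_0, ..., y_n].  For a reduced X this says that D_+(F)
   meets every irreducible component, and for an integral X that it is
   nonempty. *)
Definition dense_open (k : fieldType) (X : affScheme k) (n : nat)
    (F : cone_ring X n) : Prop :=
  forall G : cone_ring X n, cone_null (F * G) -> cone_null G.

(* C is the coordinate ring of the affine open subset D_+(F) of X * P^n, for F
   homogeneous of degree e > 0, that is, the degree 0 part of the localization
   of (A/I)[y_0, ..., y_n] at F.  The value frac r G is the fraction G / F ^ r;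
   it is meaningful for G homogeneous of degree r * e only. *)
Record is_coord_ring (k : fieldType) (X : affScheme k) (n e : nat)
    (F : cone_ring X n) (C : comAlgType k)
    (frac : nat -> cone_ring X n -> C) : Prop := IsCoordRing {
  frac_linear : forall (r : nat) (a : k) (G H : cone_ring X n),
    G \is (r * e)%N.-homog -> H \is (r * e)%N.-homog ->
    frac r ((a%:A : aff_ring X) *: G + H) = a *: frac r G + frac r H;
  frac_mul : forall (r s : nat) (G H : cone_ring X n),
    G \is (r * e)%N.-homog -> H \is (s * e)%N.-homog ->
    frac (r + s)%N (G * H) = frac r G * frac s H;
  frac_one : frac 0%N 1 = 1;
  frac_den : frac 1%N F = 1;
  frac_surj : forall c : C, exists (r : nat) (G : cone_ring X n),
    G \is (r * e)%N.-homog /\ c = frac r G;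
  frac_eq0 : forall (r : nat) (G : cone_ring X n),
    G \is (r * e)%N.-homog ->
    (frac r G = 0 <-> exists s : nat, cone_null (F ^+ s * G))
}.

(* X * P^m and Y * P^n are birationally equivalent over k: some dense open
   subsets are isomorphic over k.  As the D_+(F) form a basis of the topology,
   and the complement of a dense open subset lies in a hypersurface containing
   no component, it suffices to consider principal open subsets; they are
   isomorphic over k when they have a common coordinate k-algebra. *)
Definition birational (k : fieldType) (X : affScheme k) (m : nat)
    (Y : affScheme k) (n : nat) : Prop :=
  exists (d e : nat) (F : cone_ring X m) (G : cone_ring Y n),
    [/\ (0 < d)%N /\ (0 < e)%N,
        F \is d.-homog /\ G \is e.-homog,
        dense_open F /\ dense_open G &
        exists (C : comAlgType k) (fX : nat -> cone_ring X m -> C)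
               (fY : nat -> cone_ring Y n -> C),
          is_coord_ring d F fX /\ is_coord_ring e G fY].

Definition stably_rational (k : fieldType) (X : affScheme k) : Prop :=
  exists n N : nat, birational X n (Spec_base k) N.

(* The missing join of the library's structures on a product: it makes
   K1 * K2 an falgType. *)
HB.instance Definition _ (k : fieldType) (A B : falgType k) :=
  Vector.on (A * B)%type.

(* The norm of the generic element \sum_i 'X_i e_i of K, where the e_i form a
   k-basis of K: the determinant of multiplication by this element.  For a
   commutative k-algebra R, evaluation at (x_i) in R^d gives
   N_{K (x) R / R} (\sum_i x_i e_i). *)
Definition norm_form (k : fieldType) (K : falgType k) :
    {mpoly k[\dim {:K}]} :=
  let e := vbasis {:K} in
  \det (\sum_(i < \dim {:K})
          'X_i *: map_mx (@mpolyC _ k) (passmx.mxof e e (amulr e`_i))).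

(* The kernel of N_{K/k} : Res_{K/k} G_m -> G_m.  The Weil restriction of G_m is
   the open subset of the affine space of K on which norm_form is invertible, so
   the kernel is the closed subscheme norm_form = 1 of that affine space. *)
Definition norm_one_torus (k : fieldType) (K : falgType k) : affScheme k :=
  @AffScheme k {mpoly k[\dim {:K}]}
    (fun p => exists q, p = q * (norm_form K - 1)).

(* Main.v *)
From HB Require Import structures.
Require Import Defs.
From mathcomp Require Import all_boot all_order all_algebra all_fingroup.
From mathcomp Require Import all_solvable all_field.
From mathcomp Require Import mpoly ring.
From Stdlib Require Import ClassicalEpsilon.

Set Implicit Arguments.
Unset Strict Implicit.
Unset Printing Implicit Defensive.

Import GRing.Theory.
Local Open Scope ring_scope.

(** The torus T is even rational: it is the quotient of a quasi-trivial torus by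
    a quasi-trivial subtorus, and this quotient can be written down.

    Let E = K1 K2 and n = 2 m.  The Galois group of E / k is dihedral of order
    2 n, and K1, K2 are the fixed fields of two reflections, since a subgroup of
    order 2 which is not normal is generated by a reflection.  As K1 and K2 are
    not conjugate, these reflections lie in the two different classes.  Replacing
    K2 by a conjugate, which amounts to changing the embedding of K2 into E, one
    may take reflections s and t such that t = s rho, where rho generates the
    group of rotations.  The rotations restrict to the n embeddings of K1 and to
    those of K2, so T consists of the pairs (x, y) such that the product of all
    the rho^i (x) rho^i (y) is 1.  Such pairs arise from c in k and z in E, both
    nonzero, by

      x = z s(z) / c,    y = c / (z t(z)).

    (In terms of characters: the vertices and the edges of a regular n-gon are
    the embeddings of K1 and of K2, its flags are those of E, and a flag is sent
    to its vertex minus its edge.)  Conversely x s(y) = z / rho(z), so that z is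
    found by Hilbert's Theorem 90, up to a factor f in the fixed field F of rho,
    and c is then z s(z) / x; the factor f changes c by f s(f), which is the norm
    of f from F to k.  With an F-linear form l on E this ambiguity is removed by
    the normalization l(z) = 1, and (c, z) runs through an affine space over k.
    The inverse map is polynomial up to denominators: for u = x s(y), the
    resolvent of theta, that is, the sum of the
    u rho(u) ... rho^(i-1) (u) rho^i (theta), equals z Tr(theta / z), which
    is z up to a factor in F.

    As the Galois group is not abelian, k is infinite
    ([nonabelian_base_infinite]), so that all these identities between
    polynomials can be checked at k-points ([birational_of_points]).  What points
    do not give at once is that a polynomial p over k vanishing at the image of
    the parametrization is a multiple of N - 1, where N is the norm form
    ([chart_ideal]).  Over E the norm form is a product of linear forms S_i, S'_i
    ([norm_form_split]), and for c = 1 the parametrization becomes the monomial map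
    S_i = z_i z'_i, S'_i = 1 / (z_i z'_(i-1)).  The composite of p with it
    vanishes identically, since the conjugates of the elements of E are Zariski
    dense; and the monomial map has a section modulo the product of all the S_i
    and S'_i minus 1, so that p is zero modulo N - 1 ([cover_ideal]). *)

(** * Polynomials vanishing on an infinite set *)

Section PolynomialFunctions.

Variables (R : idomainType) (S : R -> Prop).

Definition infinite_in := forall N, exists s : seq R,
  [/\ uniq s, N <= size s & forall x, x \in s -> S x]%N.

Hypothesis infS : infinite_in.

Lemma poly_eq0_infinite (p : {poly R}) :
  (forall x, S x -> p.[x] = 0) -> p = 0.
Proof.
move=> p0; have [s [us les Ss]] := infS (size p).
apply: (@roots_geq_poly_eq0 _ p s) => //.
by apply/allP=> x /Ss /p0 px; apply/eqP.
Qed.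

Lemma meval_muni n (v : 'I_n -> R) (t : R) (p : {mpoly R[n.+1]}) :
  p.@[fun i => oapp v t (unlift ord_max i)]
    = (map_poly (meval v) (muni p)).[t].
Proof.
rewrite mevalE muniE !rmorph_sum /= horner_sum.
apply: eq_bigr => m _; rewrite big_ord_recr /= unlift_none /= mulrA.
rewrite map_polyZ /= map_polyXn hornerZ hornerXn; congr (_ * _).
rewrite mevalZ mevalX; congr (_ * _); apply: eq_bigr => i _.
rewrite mnmE; congr (_ ^+ _).
suff -> : widen_ord (leqnSn n) i = lift ord_max i by rewrite liftK.
by apply: val_inj; rewrite /= /bump leqNgt ltn_ord.
Qed.

(** [muni] only regroups the monomials according to the exponent of the last
    variable, so that no two of them are merged. *)
Lemma muni_inj n (p : {mpoly R[n.+1]}) : muni p = 0 -> p = 0.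
Proof.
move=> mp0; apply/mpolyP=> m0; rewrite mcoeff0.
have [m0p|/memN_msupp_eq0 //] := boolP (m0 \in msupp p).
pose r (m : 'X_{1..n.+1}) := [multinom m (widen_ord (leqnSn n) i) | i < n].
have := congr1 (fun q : {poly {mpoly R[n]}} => q`_(m0 ord_max)@_(r m0)) mp0.
rewrite /= coef0 mcoeff0 muniE coef_sum raddf_sum /= => <-.
rewrite (bigD1_seq m0) ?msupp_uniq //= [X in _ + X]big1 ?addr0.
  rewrite coefZ coefXn eqxx mulr1 mcoeffZ mcoeffX.
  by rewrite eqxx mulr1.
move=> m mm0; rewrite coefZ coefXn.
have [eqm|_] := eqVneq (m0 ord_max) (m ord_max); last by rewrite mulr0 mcoeff0.
rewrite mulr1 mcoeffZ mcoeffX.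
have [er|_] := eqVneq _ (r m0); last by rewrite mulr0.
case/eqP: mm0; apply/mnmP=> i; case: (unliftP ord_max i) => [j|] ->; last by [].
have := congr1 (fun q : 'X_{1..n} => q j) er; rewrite !mnmE.
suff -> : widen_ord (leqnSn n) j = lift ord_max j by [].
by apply: val_inj; rewrite /= /bump leqNgt ltn_ord.
Qed.

(** Induction on the number of variables: fixing all the variables but the last
    gives a univariate polynomial with infinitely many roots, whose
    coefficients are polynomials in the other variables. *)
Lemma mpoly_eq0_infinite n (p : {mpoly R[n]}) :
  (forall v, (forall i, S (v i)) -> p.@[v] = 0) -> p = 0.
Proof.
elim: n p => [|n IHn] p p0.
  have := p0 (fun=> 0).
  have -> : p = (p@_0)%:MP.
    apply/mpolyP=> m; have -> : m = 0%MM by apply/mnmP; case.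
    by rewrite mcoeffC eqxx mulr1.
  by rewrite mevalC => p00; rewrite p00 ?mpolyC0 //; case.
apply: muni_inj; apply/polyP=> j; rewrite coef0; apply: IHn => v Sv.
have q0 : map_poly (meval v) (muni p) = 0.
  apply: poly_eq0_infinite => t St; rewrite -meval_muni; apply: p0 => i.
  by case: (unlift _ _) => [k|] /=; [apply: Sv|].
by rewrite -(coef_map (meval v)) q0 coef0.
Qed.

End PolynomialFunctions.

(** * Homogenized evaluation *)

Section HomogenizedEvaluation.

Variables (n : nat) (R : nzRingType).
Implicit Types p : {mpoly R[n]}.

(** The homogenization of p with respect to an extra variable, evaluated at a and
    at g for this variable: the numerator of p (a / g) for the denominator
    g ^+ msize p, which makes sense in rings where g has no inverse. *)
Definition heval (S : comNzRingType) (f : R -> S) (a : 'I_n -> S) (g : S) p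
    : S :=
  \sum_(m <- msupp p) f p@_m * mmap1 a m * g ^+ (msize p - mdeg m).

Lemma rmorph_heval (S S' : comNzRingType) (h : {rmorphism S -> S'})
    (f : R -> S) (a : 'I_n -> S) (g : S) p :
  h (heval f a g p) = heval (h \o f) (h \o a) (h g) p.
Proof.
rewrite rmorph_sum; apply: eq_bigr => m _.
rewrite !rmorphM rmorphXn; congr (_ * _ * _).
by rewrite rmorph_prod; apply: eq_bigr => i _; rewrite rmorphXn.
Qed.

Lemma eq_heval (S : comNzRingType) (f f' : R -> S) (a a' : 'I_n -> S) (g : S)
    p :
  f =1 f' -> a =1 a' -> heval f a g p = heval f' a' g p.
Proof.
move=> ff aa; apply: eq_bigr => m _; rewrite ff; congr (_ * _ * _).
exact: mmap1_eq.
Qed.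

Lemma heval_scale (S : comNzRingType) (f : R -> S) (b : 'I_n -> S) (g : S) p :
  heval f (fun i => g * b i) g p = g ^+ msize p * mmap f b p.
Proof.
rewrite mulr_sumr; apply: eq_big_seq => m pm.
have -> : mmap1 (fun i => g * b i) m = g ^+ mdeg m * mmap1 b m.
  rewrite mdegE -prodrXr -big_split /=.
  by apply: eq_bigr => i _; rewrite exprMn.
rewrite -[in RHS](subnKC (ltnW (msize_mdeg_lt pm))) exprD.
by rewrite [X in X * _]mulrCA [LHS]mulrAC.
Qed.

End HomogenizedEvaluation.

Section Homogenization.

Variables (R : comNzRingType) (n N : nat) (a : 'I_n -> {mpoly R[N]}).
Hypothesis a_homog : forall i, a i \is 1.-homog.

Lemma dhomog_mmap1 m : mmap1 a m \is (mdeg m).-homog.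
Proof.
rewrite /mmap1 mdegE.
elim/big_rec2: _ => [|i q d _ qd]; first exact: dhomog1.
by apply: dhomogM => //; have := dhomogMn (m i) (a_homog i); rewrite mul1n.
Qed.

Lemma dhomog_heval (g : {mpoly R[N]}) (p : {mpoly R[n]}) :
  g \is 1.-homog -> heval (@mpolyC N R) a g p \is (msize p).-homog.
Proof.
move=> g1; rewrite /heval big_seq; apply: rpred_sum => m pm.
have c1 : (p@_m)%:MP * mmap1 a m \is (mdeg m).-homog.
  by rewrite mul_mpolyC rpredZ // dhomog_mmap1.
have := dhomogM c1 (dhomogMn (msize p - mdeg m)%N g1).
by rewrite mul1n subnKC // ltnW // msize_mdeg_lt.
Qed.

End Homogenization.

(** * Subalgebras of a field *)

Section Subalgebra.

Variables (k E : fieldType) (iota : {rmorphism k -> E}).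

(** Subalgebras are given by Prop-valued predicates, as those of interest here are
    unions of images; classical logic turns them into the boolean predicates that
    subtypes are made of. *)
Record subalgebra := Subalgebra {
  subalg_mem : E -> Prop;
  subalg_const : forall a, subalg_mem (iota a);
  subalg_sub : forall x y, subalg_mem x -> subalg_mem y -> subalg_mem (x - y);
  subalg_mul : forall x y, subalg_mem x -> subalg_mem y -> subalg_mem (x * y)
}.

Variable S : subalgebra.

Definition in_subalg : {pred E} :=
  fun x => if excluded_middle_informative (subalg_mem S x) then true else false.

Lemma in_subalgP x : reflect (subalg_mem S x) (x \in in_subalg).
Proof.
rewrite unfold_in; case: excluded_middle_informative => Sx.
  exact: ReflectT.
exact: ReflectF.
Qed.

Lemma in_subalg_subring : subring_closed in_subalg.
Proof.
split=> [|x y /in_subalgP Sx /in_subalgP Sy|x y /in_subalgP Sx /in_subalgP Sy].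
- by apply/in_subalgP; rewrite -(rmorph1 iota); apply: subalg_const.
- exact/in_subalgP/subalg_sub.
- exact/in_subalgP/subalg_mul.
Qed.

HB.instance Definition _ :=
  GRing.isSubringClosed.Build E in_subalg in_subalg_subring.

Record subalg_type := SubalgType {
  subalg_val :> E;
  subalg_valP : subalg_val \in in_subalg
}.

HB.instance Definition _ := [isSub for subalg_val].
HB.instance Definition _ := [Choice of subalg_type by <:].
HB.instance Definition _ := [SubChoice_isSubComNzRing of subalg_type by <:].

Fact iota_in_subalg a : iota a \in in_subalg.
Proof. exact/in_subalgP/subalg_const. Qed.

Definition subalg_scale (a : k) (x : subalg_type) : subalg_type :=
  SubalgType (iota_in_subalg a) * x.

Fact subalg_scaleA a b x :
  subalg_scale a (subalg_scale b x) = subalg_scale (a * b) x.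
Proof. by apply: val_inj; rewrite !rmorphM /= rmorphM mulrA. Qed.
Fact subalg_scale1 : left_id 1 subalg_scale.
Proof. by move=> x; apply: val_inj; rewrite rmorphM /= rmorph1 mul1r. Qed.
Fact subalg_scaleDr : right_distributive subalg_scale +%R.
Proof. by move=> a x y; rewrite /subalg_scale mulrDr. Qed.
Fact subalg_scaleDl x : {morph subalg_scale^~ x : a b / a + b}.
Proof.
by move=> a b; apply: val_inj; rewrite rmorphD !rmorphM /= rmorphD mulrDl.
Qed.

HB.instance Definition _ := GRing.Zmodule_isLmodule.Build k subalg_type
  subalg_scaleA subalg_scale1 subalg_scaleDr subalg_scaleDl.

Fact subalg_scaleAl a (x y : subalg_type) : a *: (x * y) = a *: x * y.
Proof. by rewrite [LHS]mulrA. Qed.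

HB.instance Definition _ :=
  GRing.Lmodule_isLalgebra.Build k subalg_type subalg_scaleAl.
HB.instance Definition _ :=
  GRing.Lalgebra_isComAlgebra.Build k subalg_type.

(** The map g is a total function inverse to f on the subalgebra; with it,
    fractions in E can be turned into elements of C without any proof
    argument. *)
Lemma subalg_algebra : exists (C : comAlgType k) (f : {rmorphism C -> E})
    (g : E -> C),
  [/\ injective f, forall a c, f (a *: c) = iota a * f c,
      forall x, subalg_mem S x -> f (g x) = x & forall c, subalg_mem S (f c)].
Proof.
exists subalg_type, (val : {rmorphism subalg_type -> E}).
exists (insubd (0 : subalg_type)); split.
- exact: val_inj.
- by [].
- by move=> x /in_subalgP Sx; rewrite /= [LHS]insubdK.
- by case=> x Sx; apply/in_subalgP.
Qed.

End Subalgebra.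

(** * Coordinate rings inside a field *)

Section CoordinateRing.

Variables (k E : fieldType) (iota : {rmorphism k -> E}).
Variables (X : affScheme k) (n : nat).
Variable phi : {rmorphism cone_ring X n -> E}.
(** [phi] presents the cone ring in a field up to its null ideal; injectivity is
    asked in each degree only, so that one of the homogeneous coordinates may be
    sent to 1. *)
Hypothesis phi_const : forall a, phi ((a%:A : aff_ring X)%:MP) = iota a.
Hypothesis phi_eq0 : forall r (H : cone_ring X n),
  H \is r.-homog -> (phi H = 0 <-> cone_null H).

Definition degree0_frac (e : nat) (F : cone_ring X n) (x : E) : Prop :=
  exists r (H : cone_ring X n), H \is (r * e)%N.-homog /\ x = phi H / phi F ^+ r.

(** In a fixed degree, [phi] makes the cone ring a domain; a general G is treated
    one homogeneous component at a time. *)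
Lemma dense_open_field e (F : cone_ring X n) :
  F \is e.-homog -> phi F != 0 -> dense_open F.
Proof.
move=> Fe F0 G FG m.
have null0 : aff_ideal (0 : aff_ring X).
  have /phi_eq0 [+ _] := @dhomog0 n.+1 (aff_ring X) mdeg 0.
  by move=> /(_ (rmorph0 _)) /(_ 0%MM); rewrite mcoeff0.
pose d := mdeg m; pose Gd := pihomog mdeg d G.
have Gdh : Gd \is d.-homog by apply: pihomogP.
have coef_pihomog (p : cone_ring X n) c m' :
    (pihomog mdeg c p)@_m' = if mdeg m' == c then p@_m' else 0.
  rewrite pihomogE raddf_sum /= big_mkcond /=.
  have [mp|mNp] := boolP (m' \in msupp p).
    rewrite (bigD1_seq m') ?msupp_uniq //= big1 => [|m1 m1m'].
      by case: ifP; rewrite ?addr0 // mcoeffZ mcoeffX eqxx mulr1.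
    by case: ifP => // _; rewrite mcoeffZ mcoeffX (negPf m1m') mulr0.
  rewrite (memN_msupp_eq0 mNp) if_same big1_seq // => m1 /andP[_ m1p].
  case: ifP => // _; rewrite mcoeffZ mcoeffX; case: eqP => [m1m'|]; last first.
    by rewrite mulr0.
  by rewrite -m1m' m1p in mNp.
have FGd : F * Gd = pihomog mdeg (e + d) (F * G).
  pose w := maxn (msize G) d.+1.
  have -> : F * G = \sum_(i < w) F * pihomog mdeg i G.
    by rewrite -mulr_sumr -pihomog_partitionE ?leq_maxl.
  rewrite linear_sum /=.
  have dw : (d < w)%N by apply: leq_maxr.
  rewrite (bigD1 (Ordinal dw)) //= [X in _ + X]big1 ?addr0 => [|i id].
    by rewrite pihomog_dE // dhomogM // pihomogP.
  apply: (@pihomog_ne0 _ _ _ (e + i)%N); last by rewrite dhomogM // pihomogP.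
  by rewrite eqn_add2l; apply: contra id => /eqP ?; apply/eqP/val_inj.
have : cone_null (F * Gd).
  by move=> m'; rewrite FGd coef_pihomog; case: ifP.
move/(phi_eq0 (dhomogM Fe Gdh)); rewrite rmorphM => /eqP.
rewrite mulf_eq0 (negPf F0) /= => /eqP /(phi_eq0 Gdh) /(_ m).
by rewrite coef_pihomog eqxx.
Qed.

Variables (C : comAlgType k) (f : {rmorphism C -> E}) (g : E -> C).
Hypothesis f_inj : injective f.
Hypothesis f_scale : forall a c, f (a *: c) = iota a * f c.
Variables (e : nat) (F : cone_ring X n).
Hypothesis fgK : forall x, degree0_frac e F x -> f (g x) = x.
Hypothesis f_frac : forall c, degree0_frac e F (f c).
Hypothesis F_homog : F \is e.-homog.
Hypothesis phiF_neq0 : phi F != 0.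

(** All the axioms are read off in E, where the fraction G / F ^ r is the quotient
    of the images. *)
Lemma is_coord_ring_field :
  is_coord_ring e F (fun r H => g (phi H / phi F ^+ r)).
Proof.
have fg r H : H \is (r * e)%N.-homog ->
    f (g (phi H / phi F ^+ r)) = phi H / phi F ^+ r.
  by move=> Hh; apply: fgK; exists r, H.
split=> [r a G H Gh Hh|r s G H Gh Hh|||c|r G Gh].
- apply: f_inj; rewrite (rmorphD f) /= f_scale !fg ?rpredD ?rpredZ //.
  by rewrite -mul_mpolyC rmorphD rmorphM /= phi_const mulrDl mulrA.
- apply: f_inj; rewrite (rmorphM f) /= !fg ?mulnDl ?dhomogM //.
  by rewrite rmorphM exprD invfM mulrACA.
- by apply: f_inj; rewrite fg ?mul0n ?dhomog1 // (rmorph1 f) rmorph1 expr0 divr1.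
- by apply: f_inj; rewrite fg ?mul1n // (rmorph1 f) expr1 divff.
- have [r [H [Hh fc]]] := f_frac c; exists r, H; split=> //.
  by apply: f_inj; rewrite fg.
have -> : (g (phi G / phi F ^+ r) = 0) <-> phi G = 0.
  split=> [/(congr1 f)|G0]; last by apply: f_inj; rewrite fg // G0 mul0r (rmorph0 f).
  rewrite fg // (rmorph0 f) => /eqP; rewrite mulf_eq0 invr_eq0 expf_eq0.
  by rewrite (negPf phiF_neq0) andbF orbF => /eqP.
have FsG s : F ^+ s * G \is (e * s + r * e)%N.-homog.
  by rewrite dhomogM // dhomogMn.
split=> [G0|[s /(phi_eq0 (FsG s))]].
  by exists 0; apply/(phi_eq0 (FsG 0)); rewrite rmorphM G0 mulr0.
move/eqP; rewrite rmorphM mulf_eq0 rmorphXn expf_eq0 (negPf phiF_neq0) andbF /=.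
by move/eqP.
Qed.

End CoordinateRing.

(** * Localizations inside a field *)

Section Localization.

Variables (k E : fieldType) (iota : {rmorphism k -> E}).
Implicit Types S T : subalgebra iota.

Definition loc S (x y : E) : Prop :=
  exists r u, subalg_mem S u /\ y = u / x ^+ r.

Lemma subalg_exp S x r : subalg_mem S x -> subalg_mem S (x ^+ r).
Proof.
move=> Sx; elim: r => [|r IHr].
  by rewrite expr0 -(rmorph1 iota); apply: subalg_const.
by rewrite exprS; apply: subalg_mul.
Qed.

Lemma loc_subalg S x : subalg_mem S x -> x != 0 ->
  exists T, forall y, subalg_mem T y <-> loc S x y.
Proof.
move=> Sx x0.
have lc a : loc S x (iota a).
  by exists 0, (iota a); rewrite expr0 divr1; split=> //; apply: subalg_const.
have lb y z : loc S x y -> loc S x z -> loc S x (y - z).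
  move=> [r [u [Su ->]]] [s [v [Sv ->]]].
  exists (r + s), (u * x ^+ s - v * x ^+ r); split.
    by apply: subalg_sub; apply: subalg_mul => //; apply: subalg_exp.
  rewrite exprD mulrBl; congr (_ - _).
    by rewrite -mulf_div mulfV ?mulr1 // expf_neq0.
  by rewrite [x ^+ r * _]mulrC -mulf_div mulfV ?mulr1 // expf_neq0.
have lm y z : loc S x y -> loc S x z -> loc S x (y * z).
  move=> [r [u [Su ->]]] [s [v [Sv ->]]].
  exists (r + s), (u * v); split; first exact: subalg_mul.
  by rewrite exprD mulf_div.
by exists (Subalgebra lc lb lm).
Qed.

(** Both localizations arise from inverting f and g: indeed f * a = f ^+ r.+1 * g
    and g * b = g ^+ s.+1 * f. *)
Lemma loc_incl S1 S2 f g a b r s :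
    subalg_mem S1 f -> f != 0 -> subalg_mem S2 g -> g != 0 ->
    subalg_mem S1 a -> g = a / f ^+ r -> subalg_mem S2 b -> f = b / g ^+ s ->
    (forall x, subalg_mem S1 x -> loc S2 g x) ->
  forall x, loc S1 (f * a) x -> loc S2 (g * b) x.
Proof.
move=> S1f f0 S2g g0 S1a ga S2b fb S12 x.
have b0 : b != 0 by apply: contraNneq f0 => b0; rewrite fb b0 mul0r.
have [|T TE] := loc_subalg (subalg_mul S2g S2b); first exact: mulf_neq0.
have T2 y : subalg_mem S2 y -> subalg_mem T y.
  by move=> S2y; apply/TE; exists 0, y; rewrite expr0 divr1.
have Tg : subalg_mem T g^-1.
  by apply/TE; exists 1, b; split=> //; rewrite expr1 invfM mulrCA mulfV ?mulr1.
have Tf : subalg_mem T f^-1.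
  apply/TE; exists 1, (g ^+ s.+1); split; first exact: subalg_exp.
  by rewrite {1}fb invf_div expr1 invfM exprS mulrACA mulfV // mul1r.
have T1 y : subalg_mem S1 y -> subalg_mem T y.
  move=> /S12[t [u [S2u ->]]]; rewrite -exprVn.
  by apply: subalg_mul; [apply: T2 | apply: subalg_exp].
move=> [t [u [S1u ->]]]; apply/TE; apply: subalg_mul; first exact: T1.
rewrite -exprVn; apply: subalg_exp.
have -> : f * a = f ^+ r.+1 * g.
  by rewrite ga exprS -mulrA; congr (_ * _); rewrite mulrC divfK ?expf_neq0.
by rewrite invfM -exprVn; apply: subalg_mul => //; apply: subalg_exp.
Qed.

(** The algebraic form of the statement that birational affine varieties have
    isomorphic principal open subsets. *)
Lemma common_localization S1 S2 f g :
    subalg_mem S1 f -> f != 0 -> subalg_mem S2 g -> g != 0 ->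
    (forall x, subalg_mem S1 x -> loc S2 g x) ->
    (forall x, subalg_mem S2 x -> loc S1 f x) ->
  exists F G, [/\ subalg_mem S1 F /\ F != 0, subalg_mem S2 G /\ G != 0 &
    forall x, loc S1 F x <-> loc S2 G x].
Proof.
move=> S1f f0 S2g g0 S12 S21.
have [r [a [S1a ga]]] := S21 _ S2g; have [s [b [S2b fb]]] := S12 _ S1f.
have a0 : a != 0 by apply: contraNneq g0 => a0; rewrite ga a0 mul0r.
have b0 : b != 0 by apply: contraNneq f0 => b0; rewrite fb b0 mul0r.
exists (f * a), (g * b).
split; [by split; [apply: subalg_mul | apply: mulf_neq0].. | move=> x].
by split; [apply: (loc_incl _ _ _ _ _ ga _ fb) | apply: (loc_incl _ _ _ _ _ fb _ ga)].
Qed.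

End Localization.

(** A ring morphism from a polynomial ring is an evaluation; this turns [heval]
    into a formula for arbitrary morphisms. *)
Lemma rmorph_mpoly n (R : nzRingType) (S : comNzRingType)
    (f : {rmorphism {mpoly R[n]} -> S}) (p : {mpoly R[n]}) :
  f p = mmap (f \o @mpolyC n R) (fun i => f 'X_i) p.
Proof.
rewrite {1}(mpolyE p) rmorph_sum; apply: eq_bigr => m _.
rewrite -mul_mpolyC rmorphM; congr (_ * _).
rewrite mpolyXE_id rmorph_prod.
by apply: eq_bigr => i _; rewrite rmorphXn.
Qed.

(** * Dehomogenization *)

Section Dehomogenization.

Local Notation "x %:F" := (@FracField.tofrac _ x).

Variables (k : fieldType) (N : nat).

Definition dehomog : {mpoly k[N.+1]} -> {mpoly k[N]} :=
  mmap (@mpolyC N k) (fun i => oapp (fun j => 'X_j) 1 (unlift ord0 i)).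

HB.instance Definition _ := GRing.RMorphism.on dehomog.

Lemma dehomogX0 : dehomog 'X_ord0 = 1.
Proof. by rewrite /dehomog mmapX mmap1U unlift_none. Qed.

Lemma dehomogXS j : dehomog 'X_(lift ord0 j) = 'X_j.
Proof. by rewrite /dehomog mmapX mmap1U liftK. Qed.

Lemma dehomogC c : dehomog c%:MP = c%:MP.
Proof. by rewrite /dehomog mmapC. Qed.

Lemma mmap_homog_scale n (S : comNzRingType) (f : k -> S) (b : 'I_n -> S) c r
    (H : {mpoly k[n]}) :
  H \is r.-homog -> mmap f (fun i => c * b i) H = c ^+ r * mmap f b H.
Proof.
move=> /dhomogP Hh; rewrite mulr_sumr; apply: eq_big_seq => m Hm.
have rm : mdeg m = r by apply: Hh.
rewrite -rm [RHS]mulrCA; congr (_ * _).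
rewrite mdegE -prodrXr -big_split /=.
by apply: eq_bigr => i _; rewrite exprMn.
Qed.

(** A homogeneous H of degree r is recovered from its dehomogenization: it is
    X_0 ^ r times the value of [dehomog H] at the X_(j+1) / X_0. *)
Lemma dehomog_eq0 r (H : {mpoly k[N.+1]}) :
  H \is r.-homog -> dehomog H = 0 -> H = 0.
Proof.
move=> Hh DH0; pose F := {fraction {mpoly k[N.+1]}}.
pose c (a : k) : F := (a%:MP)%:F.
pose theta : {mpoly k[N]} -> F :=
  mmap (@FracField.tofrac _ \o @mpolyC N.+1 k) (fun j => ('X_(lift ord0 j))%:F / ('X_ord0)%:F).
have X0 : ('X_ord0 : {mpoly k[N.+1]})%:F != 0 :> F.
  by rewrite tofrac_eq0 -msupp_eq0 msuppX.
have : ('X_ord0)%:F ^+ r * theta (dehomog H) = H%:F.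
  have -> : theta (dehomog H)
      = mmap (@FracField.tofrac _ \o @mpolyC N.+1 k) (fun i => ('X_i)%:F / ('X_ord0)%:F) H.
    rewrite -[LHS]/((theta \o dehomog) H) rmorph_mpoly.
    apply: eq_bigr => m _; congr (_ * _); first by rewrite /= dehomogC /theta mmapC.
    apply: mmap1_eq => i /=; case: (unliftP ord0 i) => [j|] ->.
      by rewrite dehomogXS /theta mmapX mmap1U.
    by rewrite dehomogX0 rmorph1 divff.
  rewrite -(mmap_homog_scale _ _ _ Hh) [RHS]rmorph_mpoly.
  apply: eq_bigr => m _; congr (_ * _).
  by apply: mmap1_eq => i /=; rewrite mulrC divfK.
by rewrite DH0 /theta rmorph0 mulr0 => /esym/eqP; rewrite tofrac_eq0 => /eqP.
Qed.

Definition homogenize : {mpoly k[N]} -> {mpoly k[N.+1]} :=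
  heval (@mpolyC N.+1 k) (fun j => 'X_(lift ord0 j)) 'X_ord0.

Lemma homogenize_homog b : homogenize b \is (msize b).-homog.
Proof. by apply: dhomog_heval => [i|]; rewrite dhomogX; apply/eqP/mdeg1. Qed.

Lemma homogenizeK b : dehomog (homogenize b) = b.
Proof.
rewrite /homogenize rmorph_heval /= dehomogX0.
rewrite (@eq_heval _ _ _ _ (@mpolyC N k) _ (fun j => 1 * 'X_j)) => [|c|j] /=.
- rewrite heval_scale expr1n mul1r.
  by rewrite -[RHS]/(idfun b) (rmorph_mpoly idfun).
- exact: dehomogC.
- by rewrite dehomogXS mul1r.
Qed.

End Dehomogenization.

(** * A birationality criterion in function fields *)

Lemma expf_mulKf (F : fieldType) (c x : F) n :
  c != 0 -> x = c ^+ n * x / c ^+ n.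
Proof. by move=> c0; rewrite mulrAC divff ?mul1r // expf_neq0. Qed.

Section BirationalCriterion.

Variables (k : fieldType) (d N : nat) (I : {mpoly k[d]} -> Prop).
Local Notation A := {mpoly k[d]}.
Local Notation B := {mpoly k[N]}.
(** Any field containing B can play the role of its fraction field. *)
Variables (E : fieldType) (frac : {rmorphism B -> E}).
Hypothesis frac_inj : injective frac.
Local Notation "x %:F" := (frac x).
Local Notation X := (@AffScheme k A I).
Local Notation Y := (Spec_base k).

Let frac_eq0 b : (b%:F == 0) = (b == 0).
Proof. by rewrite -(inj_eq frac_inj) rmorph0. Qed.

Definition frac_const : {rmorphism k -> E} := frac \o @mpolyC N k.

Definition frac_poly : subalgebra frac_const.
Proof.
refine (@Subalgebra _ _ _ (fun x => exists b : B, x = b%:F) _ _ _).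
- by move=> a; exists a%:MP.
- by move=> _ _ [b ->] [c ->]; exists (b - c); rewrite rmorphB.
- by move=> _ _ [b ->] [c ->]; exists (b * c); rewrite rmorphM.
Defined.

Definition eval_dehomog : {rmorphism cone_ring Y N -> E} :=
  frac \o @dehomog k N.

Lemma eval_dehomogE (H : {mpoly k[N.+1]}) : eval_dehomog H = (dehomog H)%:F.
Proof. by []. Qed.

Lemma eval_dehomog_eq0 r (H : cone_ring Y N) :
  H \is r.-homog -> (eval_dehomog H = 0 <-> cone_null H).
Proof.
move=> Hh; split=> [/eqP|H0].
  rewrite eval_dehomogE frac_eq0 => /eqP /(dehomog_eq0 Hh) -> m /=.
  exact: mcoeff0.
have -> : H = 0 by apply/mpolyP=> m; rewrite mcoeff0; apply: H0.
exact: rmorph0.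
Qed.

(** The degree of a homogenized numerator need not be a multiple of that of the
    denominator.  The extra factor X_0 in the denominator, which dehomogenizes to
    1, leaves room to adjust it. *)
Lemma loc_eval_dehomog (G : B) x : G != 0 ->
  loc frac_poly G%:F x <->
  degree0_frac eval_dehomog (msize G).+1 (homogenize G * 'X_ord0) x.
Proof.
move=> G0.
have G0F : G%:F != 0 :> E by rewrite frac_eq0.
have GE : eval_dehomog (homogenize G * 'X_ord0) = G%:F.
  by rewrite eval_dehomogE rmorphM /= homogenizeK dehomogX0 mulr1.
split=> [[r [_ [[b ->] ->]]]|[r [H [_ ->]]]]; last first.
  by exists r, (eval_dehomog H); split; [exists (dehomog H) | rewrite GE].
set D := msize b; set e := (msize G).+1.
(* multiplying by G ^ D / G ^ D gives degree D + (e - 1) D + r e = (r + D) e *)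
exists (r + D), (homogenize b * homogenize G ^+ D * 'X_ord0 ^+ (r * e)); split.
  have -> : ((r + D) * e = D + msize G * D + 1 * (r * e))%N.
    by rewrite /e mulnDl mul1n [RHS]addnC mulnS [(D * _)%N]mulnC.
  apply: dhomogM; last by apply: dhomogMn; rewrite dhomogX; apply/eqP/mdeg1.
  by apply: dhomogM; [|apply: dhomogMn]; apply: homogenize_homog.
rewrite GE eval_dehomogE !rmorphM !rmorphXn /= dehomogX0 !homogenizeK.
rewrite rmorph1 expr1n mulr1 exprD -mulf_div divff ?mulr1 //.
by rewrite expf_neq0.
Qed.

Variable phi : {rmorphism A -> E}.
Hypothesis phi_const : forall c, phi c%:MP = frac_const c.
Hypothesis phi_eq0 : forall p, phi p = 0 <-> I p.

Definition frac_image : subalgebra frac_const.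
Proof.
refine (@Subalgebra _ _ _ (fun x => exists p : A, x = phi p) _ _ _).
- by move=> a; exists a%:MP; rewrite phi_const.
- by move=> _ _ [b ->] [c ->]; exists (b - c); rewrite rmorphB.
- by move=> _ _ [b ->] [c ->]; exists (b * c); rewrite rmorphM.
Defined.

Definition eval_cone : {rmorphism cone_ring X 0 -> E} :=
  mmap phi (fun _ : 'I_1 => 1).

Lemma eval_coneE p m : eval_cone (p *: 'X_[m]) = phi p.
Proof.
rewrite -[LHS]/(mmap phi _ _) mmapZ mmapX /mmap1 big1 ?mulr1 // => i _.
exact: expr1n.
Qed.

(** For P^0 there is one homogeneous coordinate, so that the cone ring in degree r
    is a copy of A. *)
Lemma homog1_monomial r (H : cone_ring X 0) :
  H \is r.-homog -> exists p, H = p *: 'X_ord0 ^+ r.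
Proof.
move=> /dhomogP Hh; exists (H@_(U_(ord0) *+ r)); rewrite mpolyXn.
apply/mpolyP=> m; rewrite mcoeffZ mcoeffX.
have [<-|mr] := eqVneq; first by rewrite mulr1.
rewrite mulr0; apply: memN_msupp_eq0; apply: contra mr => /Hh mr.
apply/eqP/mnmP=> i; rewrite mulmnE mnm1E (ord1 i) eqxx mul1n -mr.
by rewrite /= mdegE big_ord1.
Qed.

Lemma eval_cone_eq0 r (H : cone_ring X 0) :
  H \is r.-homog -> (eval_cone H = 0 <-> cone_null H).
Proof.
move=> /homog1_monomial[p ->]; rewrite mpolyXn eval_coneE phi_eq0.
split=> [Ip m|/(_ (U_(ord0) *+ r)%MM)]; rewrite mcoeffZ mcoeffX.
  have I0 : I 0 by apply/phi_eq0/rmorph0.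
  by case: eqP; rewrite ?mulr1 ?mulr0.
by rewrite eqxx mulr1.
Qed.

Lemma loc_eval_cone (p : A) x : phi p != 0 ->
  loc frac_image (phi p) x <->
  degree0_frac eval_cone 1 (p *: 'X_ord0 : cone_ring X 0) x.
Proof.
move=> p0; split=> [[r [_ [[q ->] ->]]]|[r [H []]]].
  exists r, (q *: 'X_ord0 ^+ r); rewrite mpolyXn !eval_coneE.
  split=> //; rewrite rpredZ // dhomogX.
  by apply/eqP; rewrite /= mdegMn mdeg1 mul1n muln1.
rewrite muln1 => /homog1_monomial[q ->] ->; rewrite mpolyXn !eval_coneE.
by exists r, (phi q); split=> //; exists q.
Qed.

Variables (g : B) (psi : 'I_d -> B) (h : A) (eta : 'I_N -> A).
Hypothesis g_neq0 : g != 0.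
Hypothesis phi_var : forall i, g%:F * phi 'X_i = (psi i)%:F.
Hypothesis phi_h : phi h != 0.
Hypothesis phi_inv : forall j, phi h * ('X_j)%:F = phi (eta j).

(** [phi] maps A to a field with kernel I, so that A / I and B are two subalgebras
    of E.  By [phi_var] and [phi_inv] each lies in a localization of the other. *)
Theorem birational_of_frac : birational X 0 Y N.
Proof.
have gF : g%:F != 0 :> E by rewrite frac_eq0.
have S12 x : subalg_mem frac_image x -> loc frac_poly g%:F x.
  move=> [p ->]; exists (msize p), (heval (@mpolyC N k) psi g p)%:F.
  split; first by exists (heval (@mpolyC N k) psi g p).
  have -> : (heval (@mpolyC N k) psi g p)%:F = g%:F ^+ msize p * phi p.
    rewrite rmorph_heval [phi p]rmorph_mpoly -heval_scale.
    by apply: eq_heval => [c|i] /=; rewrite ?phi_const ?phi_var.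
  exact: expf_mulKf gF.
have S21 x : subalg_mem frac_poly x -> loc frac_image (phi h) x.
  move=> [b ->]; exists (msize b), (phi (heval (@mpolyC d k) eta h b)).
  split; first by exists (heval (@mpolyC d k) eta h b).
  have -> : phi (heval (@mpolyC d k) eta h b) = phi h ^+ msize b * b%:F.
    rewrite rmorph_heval [b%:F]rmorph_mpoly -heval_scale.
    by apply: eq_heval => [c|i] /=; rewrite ?phi_const ?phi_inv.
  exact: expf_mulKf phi_h.
have [|||F [G [[[p ->] p0] [[b ->] b0] FG]]] :=
    @common_localization _ _ _ frac_image frac_poly (phi h) g%:F _ phi_h _ _ S12 S21.
- by exists h.
- by exists g.
- exact: gF.
have b0' : b != 0 by rewrite -frac_eq0.
have [|T TE] := @loc_subalg _ _ _ frac_poly b%:F _ b0; first by exists b.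
have [C [f [s [f_inj f_scale fsK f_mem]]]] := subalg_algebra T.
pose FX : cone_ring X 0 := p *: 'X_ord0.
pose FY : cone_ring Y N := homogenize b * 'X_ord0.
have hFX : FX \is 1.-homog by rewrite rpredZ // dhomogX; apply/eqP/mdeg1.
have hFY : FY \is (msize b).+1.-homog.
  have X1 : ('X_ord0 : {mpoly k[N.+1]}) \is 1.-homog.
    by rewrite dhomogX; apply/eqP/mdeg1.
  by have := dhomogM (homogenize_homog b) X1; rewrite addn1.
have nFX : eval_cone FX != 0 by rewrite eval_coneE.
have nFY : eval_dehomog FY != 0.
  by rewrite eval_dehomogE rmorphM /= homogenizeK dehomogX0 mulr1.
have TX x : subalg_mem T x <-> degree0_frac eval_cone 1 FX x.
  by rewrite TE -FG loc_eval_cone.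
have TY x : subalg_mem T x <-> degree0_frac eval_dehomog (msize b).+1 FY x.
  by rewrite TE loc_eval_dehomog.
exists 1, (msize b).+1, FX, FY; split=> //.
  split; [exact: (dense_open_field eval_cone_eq0 hFX nFX)|].
  exact: (dense_open_field eval_dehomog_eq0 hFY nFY).
exists C; do 2![eexists]; split.
  apply: (@is_coord_ring_field _ _ frac_const X 0 eval_cone _ _ C f s) => //.
  - by move=> a; rewrite -[LHS]/(mmap phi _ _) mmapC /= alg_mpolyC phi_const.
  - exact: eval_cone_eq0.
  - by move=> x /TX /fsK.
  - by move=> c; apply/TX.
apply: (@is_coord_ring_field _ _ frac_const Y N eval_dehomog _ _ C f s) => //.
- move=> a; transitivity (frac_const (a * 1)); last by rewrite mulr1.
  exact: (congr1 frac (@dehomogC k N (a * 1))).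
- exact: eval_dehomog_eq0.
- by move=> x /TY /fsK.
- by move=> c; apply/TY.
Qed.

End BirationalCriterion.

(** * A birationality criterion on rational points *)

Section BirationalPoints.

Variables (k : fieldType) (d N : nat) (I : {mpoly k[d]} -> Prop).
Local Notation A := {mpoly k[d]}.
Local Notation B := {mpoly k[N]}.
Variables (E : fieldType) (frac : {rmorphism B -> E}).
Hypothesis frac_inj : injective frac.
Local Notation "x %:F" := (frac x).
Hypothesis k_infinite : infinite_in (fun _ : k => True).
Variables (g : B) (psi : 'I_d -> B) (h : A) (eta : 'I_N -> A).

Let frac_eq0 b : (b%:F == 0) = (b == 0).
Proof. by rewrite -(inj_eq frac_inj) rmorph0. Qed.

Definition chart (w : 'I_N -> k) (i : 'I_d) : k := (psi i).@[w] / g.@[w].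

(** Restriction of functions along [chart], read in the function field of the
    affine space. *)
Definition pullback : {rmorphism A -> E} :=
  mmap (frac_const frac) (fun i => (psi i)%:F / g%:F).

Lemma eq0_off_hypersurface (p : B) : g != 0 ->
  (forall w, g.@[w] != 0 -> p.@[w] = 0) -> p = 0.
Proof.
move=> g0 p0; apply/eqP; rewrite -(inj_eq (mulfI g0)) mulr0; apply/eqP.
apply: (mpoly_eq0_infinite k_infinite) => w _; rewrite mevalM.
by have [->|/p0 ->] := eqVneq g.@[w] 0; rewrite ?mul0r ?mulr0.
Qed.

Definition numerator (p : A) : B := heval (@mpolyC N k) psi g p.

Lemma numerator_frac p : g != 0 ->
  (numerator p)%:F = g%:F ^+ msize p * pullback p.
Proof.
move=> g0; rewrite rmorph_heval -heval_scale; apply: eq_heval => // i /=.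
by rewrite mulrC divfK // frac_eq0.
Qed.

Lemma numerator_eval p w : g.@[w] != 0 ->
  (numerator p).@[w] = g.@[w] ^+ msize p * p.@[chart w].
Proof.
move=> gw; rewrite rmorph_heval -heval_scale; apply: eq_heval => [c|i] /=.
  exact: mevalC.
by rewrite mulrC divfK.
Qed.

Lemma pullback_eq0 p : g != 0 ->
  pullback p = 0 <-> forall w, g.@[w] != 0 -> p.@[chart w] = 0.
Proof.
move=> g0; have gF : g%:F ^+ msize p != 0 :> E by rewrite expf_neq0 ?frac_eq0.
split=> [p0 w gw|p0].
  have := numerator_eval p gw.
  have -> : numerator p = 0.
    by apply/eqP; rewrite -frac_eq0 numerator_frac // p0 mulr0.
  move=> /esym/eqP; rewrite meval0 mulf_eq0 expf_eq0 (negPf gw) andbF /=.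
  by move/eqP.
apply/eqP; rewrite -(inj_eq (mulfI gF)) mulr0 -numerator_frac // frac_eq0.
apply/eqP/eq0_off_hypersurface => // w gw.
by rewrite numerator_eval // p0 ?mulr0.
Qed.

Hypothesis I_points : forall p,
  I p <-> forall w, g.@[w] != 0 -> p.@[chart w] = 0.
Hypothesis h_neq0 : exists2 w, g.@[w] != 0 & h.@[chart w] != 0.
Hypothesis chart_inv : forall w j, g.@[w] != 0 ->
  h.@[chart w] * w j = (eta j).@[chart w].

Lemma birational_of_points_in : birational (@AffScheme k A I) 0 (Spec_base k) N.
Proof.
have [w0 gw0 hw0] := h_neq0.
have g0 : g != 0 by apply: contraNneq gw0 => ->; rewrite meval0.
have gF : g%:F != 0 :> E by rewrite frac_eq0.
apply: (birational_of_frac frac_inj (phi := pullback) _ _ g0 (h := h)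
  (psi := psi) (eta := eta)) => //.
- by move=> c; rewrite -[LHS]/(mmap _ _ _) mmapC.
- by move=> p; rewrite I_points; apply: pullback_eq0.
- move=> i; rewrite -[pullback _]/(mmap _ _ _) mmapX mmap1U.
  by rewrite mulrC divfK.
- by apply: contraNneq hw0 => /pullback_eq0 -> //.
move=> j.
(* only the existence of the exponents matters *)
have numP p : exists a (P : B), (forall w, g.@[w] != 0 ->
    P.@[w] = g.@[w] ^+ a * p.@[chart w]) /\ P%:F = g%:F ^+ a * pullback p.
  exists (msize p), (numerator p).
  by split=> [w|]; [apply: numerator_eval | apply: numerator_frac].
have [a [P [Pw PF]]] := numP h; have [b [Q [Qw QF]]] := numP (eta j).
have Q0 : g ^+ b * P * 'X_j - g ^+ a * Q = 0.
  apply: eq0_off_hypersurface => // w gw.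
  rewrite mevalB !mevalM !(rmorphXn (meval w)) /= mevalXU Pw // Qw //.
  rewrite -chart_inv //; apply/eqP; rewrite subr_eq0; apply/eqP.
  by rewrite !mulrA [_ ^+ b * _]mulrC.
move/(congr1 frac)/eqP: Q0.
rewrite (rmorphB frac) !(rmorphM frac) !(rmorphXn frac) (rmorph0 frac) PF QF.
have -> : g%:F ^+ b * (g%:F ^+ a * pullback h) * ('X_j)%:F -
   g%:F ^+ a * (g%:F ^+ b * pullback (eta j))
   = g%:F ^+ b * g%:F ^+ a * (pullback h * ('X_j)%:F - pullback (eta j)) :> E.
  by rewrite mulrBr !mulrA [_ ^+ a * _ ^+ b]mulrC.
by rewrite mulf_eq0 mulf_eq0 !expf_eq0 (negPf gF) !andbF /= subr_eq0 => /eqP.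
Qed.

End BirationalPoints.

(** Over an infinite field a birational parametrization w |-> psi w / g w of the
    zero set of I, with inverse eta / h, can be described by its values at
    k-points. *)
Theorem birational_of_points (k : fieldType) (d N : nat)
    (I : {mpoly k[d]} -> Prop) (g : {mpoly k[N]}) (psi : 'I_d -> {mpoly k[N]})
    (h : {mpoly k[d]}) (eta : 'I_N -> {mpoly k[d]}) :
    infinite_in (fun _ : k => True) ->
    (forall p, I p <-> forall w, g.@[w] != 0 -> p.@[chart g psi w] = 0) ->
    (exists2 w, g.@[w] != 0 & h.@[chart g psi w] != 0) ->
    (forall w j, g.@[w] != 0 ->
       h.@[chart g psi w] * w j = (eta j).@[chart g psi w]) ->
  birational (@AffScheme k {mpoly k[d]} I) 0 (Spec_base k) N.
Proof.
move=> kinf Ip hn0 inv.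
apply: (birational_of_points_in (frac := @FracField.tofrac {mpoly k[N]})) Ip hn0 inv => //.
by move=> x y /eqP; rewrite tofrac_eq => /eqP.
Qed.

(** * Reflections in a dihedral group *)

Section DihedralReflections.

Local Open Scope group_scope.

Variables (gT : finGroupType) (G H1 H2 : {group gT}) (m : nat).
Hypothesis m_gt0 : (0 < m)%N.
Hypothesis G_dihedral : G \isog 'D_(2 * (2 * m)).

(** As G has order 4 m, whereas x has order at most 2 m and y at most 2, both
    bounds are attained and y is not a power of x. *)
Lemma dihedral_generators : exists x y,
  [/\ x \in G, y \in G, #[x] = (2 * m)%N, y \notin <[x]> &
      [/\ y ^+ 2 = 1, x ^ y = x^-1 & <[x]> * <[y]> = G]].
Proof.
have q_gt1 : (1 < 2 * m)%N by rewrite mul2n -addnn; case: (m) m_gt0 => // n; rewrite addnS.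
have := G_dihedral; rewrite mul2n => isoG.
have [oG] := isoGrpP _ (Grp_dihedral q_gt1) isoG.
rewrite card_dihedral // in oG.
case/existsP=> -[x y] /= /eqP[defG xq y2 xy].
have{} defG: <[x]> * <[y]> = G.
  by rewrite -norm_joinEr // norms_cycle xy groupV cycle_id.
have notXy: y \notin <[x]>.
  apply/negP=> Xy.
  have : (#|G| <= 2 * m)%N.
    by rewrite -defG mulGSid ?cycle_subG // dvdn_leq ?(ltnW q_gt1) // order_dvdn xq.
  by rewrite oG -addnn -{3}[(2 * m)%N]addn0 leq_add2l leqNgt (ltnW q_gt1).
have oy: #[y] = 2%N by apply: nt_prime_order (group1_contra notXy).
have ox: #[x] = (2 * m)%N.
  have : (#[x] * #[y] = #|G|)%N.
    by rewrite -defG TI_cardMg // setIC prime_TIg ?cycle_subG // -orderE oy.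
  by rewrite oG oy -muln2 => /eqP; rewrite eqn_pmul2r // => /eqP.
have xG : x \in G by rewrite -cycle_subG -defG mulG_subl.
have yG : y \in G by rewrite -cycle_subG -defG mulG_subr.
by exists x, y.
Qed.

Lemma card2_cycle (H : {group gT}) : #|H| = 2%N ->
  exists2 s, H :=: <[s]> & #[s] = 2%N.
Proof.
move=> oH; have /cyclicP[s defH] : cyclic H by apply: prime_cyclic; rewrite oH.
by exists s; rewrite // orderE -defH.
Qed.

Hypotheses (sH1G : H1 \subset G) (sH2G : H2 \subset G).
Hypotheses (oH1 : #|H1| = 2%N) (oH2 : #|H2| = 2%N).
Hypotheses (nH1 : ~~ (H1 <| G)) (nH2 : ~~ (H2 <| G)).
Hypothesis nconj : forall g, g \in G -> H1 :^ g != H2.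

(** Nontrivial subgroups of the rotation group are normal, so that H1 and H2 are
    generated by reflections x ^ i * y and x ^ j * y.  Conjugation by x ^ a changes
    j by - 2 a; hence i and j have different parities, and a can be chosen such
    that the product of the two reflections becomes x. *)
Lemma dihedral_reflections : exists s t c,
  [/\ [/\ s \in G, t \in G & c \in G], H1 :=: <[s]> /\ #[s] = 2%N,
      H2 :=: <[t]> /\ #[t] = 2%N, #[s * t ^ c] = (2 * m)%N &
      s \notin <[s * t ^ c]> /\ G \subset <<[set s * t ^ c; s]>>].
Proof.
have [x [y [xG yG ox Xy [y2 xy defG]]]] := dihedral_generators.
have nXG : <[x]> <| G.
  rewrite /normal cycle_subG xG -defG mul_subG ?normG //.
  by rewrite norms_cycle xy groupV cycle_id.
have refl (H : {group gT}) s : H :=: <[s]> -> H \subset G -> ~~ (H <| G) ->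
    exists i, s = x ^+ i * y.
  move=> defH sHG nHG.
  have Xs : s \notin <[x]>.
    apply: contra nHG => Xs; apply: char_normal_trans nXG.
    by rewrite sub_cyclic_char ?cycle_cyclic // defH cycle_subG.
  have : s \in G by rewrite (subsetP sHG) // defH cycle_id.
  rewrite -defG => /mulsgP[_ v /cycleP[i ->] + sE].
  rewrite cycle2g; last by apply: nt_prime_order (group1_contra Xy).
  rewrite !inE => /orP[] /eqP vE; last by exists i; rewrite sE vE.
  by rewrite sE vE mulg1 mem_cycle in Xs.
have [s defH1 os] := card2_cycle oH1; have [t defH2 ot] := card2_cycle oH2.
have [i si] := refl _ _ defH1 sH1G nH1; have [j tj] := refl _ _ defH2 sH2G nH2.
have yX n : y * x ^+ n = x ^- n * y.
  by rewrite [RHS]conjgC conjVg conjXg xy expgVn invgK.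
have yXV n : y * x ^- n = x ^+ n * y.
  by rewrite [RHS]conjgC conjXg xy expgVn.
have tX a : t ^ (x ^+ a) = x ^- a * x ^+ j * x ^- a * y.
  by rewrite conjgE tj -!mulgA yX !mulgA.
have xq n : x ^+ (2 * m * n) = 1 by rewrite expgM -ox expg_order expg1n.
have q1 : (2 * m = (2 * m).-1.+1)%N by rewrite prednK // muln_gt0.
have oddq : odd (2 * m).-1 by have := oddS (2 * m).-1; rewrite -q1 oddM => /esym/negbFE.
have [ij|ij] := boolP (odd (i + j)); last first.
  (* modulo 2 m the sum j + (2 m - 1) i is j - i, without subtraction in nat *)
  pose a := (j + (2 * m).-1 * i)./2.
  have a2 : (i + (a + a) = j + 2 * m * i)%N.
    rewrite addnn halfK oddD oddM oddq /= addbC -oddD (negPf ij) subn0.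
    by rewrite addnCA -mulSn -q1.
  have ts : t ^ (x ^+ a) = s.
    rewrite tX si; congr (_ * _).
    have -> : x ^+ j = x ^+ a * x ^+ i * x ^+ a.
      by rewrite -!expgD [(a + i)%N]addnC -addnA a2 expgD xq mulg1.
    by rewrite !mulgA mulVg mul1g mulgK.
  have /negP[] := nconj (groupVr (groupX a xG)).
  by rewrite defH1 defH2 -ts cycleJ conjsgK.
pose a := (j.+1 + (2 * m).-1 * i)./2.
have a2 : (i + (a + a) = j.+1 + 2 * m * i)%N.
  rewrite addnn halfK oddD oddM oddq /= addNb addbC -oddD ij subn0.
  by rewrite addnCA -mulSn -q1.
have r : s * t ^ (x ^+ a) = x.
  have ca : x ^+ a * x^-1 = x^-1 * x ^+ a.
    by apply: commuteV; apply: commute_sym; apply: commuteX; apply: commute_refl.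
  have xj : x ^+ j = x ^+ a * x ^+ i * x ^+ a * x^-1.
    apply: (mulIg x); rewrite mulgKV -!expgD -expgSr.
    by rewrite [(a + i)%N]addnC -addnA a2 expgD xq mulg1.
  have -> : t ^ (x ^+ a) = x ^+ i * x^-1 * y.
    rewrite tX; congr (_ * _); rewrite xj -!mulgA mulKg; congr (_ * _).
    by rewrite !mulgA ca mulgK.
  rewrite si -!mulgA [y * (_ * _)]mulgA yX -!mulgA mulKVg.
  by rewrite mulgA (yXV 1%N) expg1 -mulgA -expg2 y2 mulg1.
have sX : s \notin <[x]>.
  by rewrite si groupMl ?mem_cycle.
exists s, t, (x ^+ a); rewrite r; split=> //.
- split; last exact: groupX.
  + by rewrite (subsetP sH1G) // defH1 cycle_id.
  + by rewrite (subsetP sH2G) // defH2 cycle_id.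
- split=> //.
  suff : <[x]> * <[y]> \subset <<[set x; s]>> by rewrite defG.
  apply: mul_subG; rewrite cycle_subG; first by rewrite mem_gen ?set21.
  have -> : y = x ^- i * s by rewrite si mulKg.
  by rewrite groupM ?groupV ?groupX // mem_gen ?set21 ?set22.
Qed.

End DihedralReflections.

(** * Galois groups over finite fields *)

(** Stated as an equality of structures, which can be rewritten in the type of an
    extension of k. *)
Lemma finite_field_type (k : fieldType) (r : seq k) :
  (forall x, x \in r) -> exists F : finFieldType, (F : fieldType) = k.
Proof.
move=> kr.
have pK : pcancel (fun x : k => index x r)
    (fun i => if (i < size r)%N then Some (nth 0 r i) else None).
  by move=> x; rewrite index_mem kr nth_index.
have ax : Finite.axiom (undup r).
  by move=> x; rewrite count_uniq_mem ?undup_uniq // mem_undup kr.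
(* with the class of k taken apart, the field structure of F reduces to that of k *)
case: k r kr pK ax => T c; case: c => m1 m2 m3 m4 m5 m6 m7 m8 m9 m10 m11 m12 m13 m14 m15 r kr pK ax.
set k := GRing.Field.Pack _ in r kr pK ax *.
pose cM := isCountable.Build k pK.
pose fM := isFinite.Build k ax.
pose F : finFieldType := HB.pack T k cM fM.
exists F; reflexivity.
Qed.

(** Over a finite field the Galois group is generated by the Frobenius
    automorphism. *)
Lemma finite_base_abelian (k : fieldType) (r : seq k) (L : splittingFieldType k)
    (E : {subfield L}) :
  (forall x, x \in r) -> abelian 'Gal(E / 1).
Proof.
move=> /finite_field_type[F FE]; move: L E; rewrite -FE => L E.
have [x /eqP-> _] := @finField_galois_generator F L 1 E (sub1v _).
exact: cycle_abelian.
Qed.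

Lemma nonabelian_base_infinite (k : fieldType) (L : splittingFieldType k)
    (E : {subfield L}) :
  ~~ abelian 'Gal(E / 1) -> infinite_in (fun _ : k => True).
Proof.
move=> nab; elim=> [|N [r [ur Nr _]]]; first by exists [::].
have [[x xr]|allr] := classic (exists x, x \notin r).
  by exists (x :: r); split=> //=; rewrite xr.
case/negP: nab; apply: (finite_base_abelian (r := r)) => x.
by apply/idPn => xr; apply: allr; exists x.
Qed.

(** * The norm form as a product of linear forms *)

Section SplitNorm.

Variables (k : fieldType) (L : fieldExtType k) (K : falgType k).
Local Notation d := (\dim {:K}).
Local Notation e := (vbasis {:K}).
Variables (q : nat) (sigma : 'I_q -> {linear K -> L}).
Hypothesis sigmaM : forall j x y, sigma j (x * y) = sigma j x * sigma j y.

Definition embmx : 'M[L]_(d, q) := \matrix_(i, j) sigma j e`_i.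

Definition split_form (j : 'I_q) : {mpoly L[d]} :=
  \sum_(i < d) embmx i j *: 'X_i.

(** Multiplicativity of [sigma j] says that the j-th column of [embmx] is a common
    eigenvector of the multiplications by the elements of K. *)
Lemma mul_mxof_embmx i (j : 'I_q) (i' : 'I_d) :
  \sum_l (passmx.mxof e e (amulr e`_i) i' l)%:A * embmx l j
    = embmx i' j * sigma j e`_i.
Proof.
have eB : basis_of {:K} e := vbasisP _.
rewrite [embmx i' j]mxE -sigmaM.
have -> : e`_i' * e`_i = \sum_l passmx.mxof e e (amulr e`_i) i' l *: e`_l.
  have := passmx.mul_mxof e e (amulr e`_i) (delta_mx 0 i').
  rewrite -rowE => /(congr1 (passmx.vecof e)).
  rewrite passmx.rVofK // passmx.vecof_delta lfunE /= => <-.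
  by rewrite /passmx.vecof; apply: eq_bigr => l _; rewrite mxE.
rewrite linear_sum; apply: eq_bigr => l _.
by rewrite linearZ /= [embmx l j]mxE mulr_algl.
Qed.

Lemma det_conj_diag (R : comNzRingType) n m (D : 'M[R]_n) (M : 'M[R]_(n, m))
    (B : 'M[R]_(m, n)) (s : 'rV[R]_m) :
  n = m -> B *m M = 1%:M -> D *m M = M *m diag_mx s -> \det D = \prod_j s 0 j.
Proof.
move=> nm; subst m => BM DM; have MB := mulmx1C BM.
have -> : D = M *m diag_mx s *m B by rewrite -DM -mulmxA MB mulmx1.
rewrite !det_mulmx det_diag mulrAC -det_mulmx mulmx1C //.
by rewrite det1 mul1r.
Qed.

(** [embmx] diagonalizes the multiplication by the generic element. *)
Lemma norm_form_split (B : 'M[L]_(q, d)) : d = q -> B *m embmx = 1%:M ->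
  map_mpoly (in_alg L) (norm_form K) = \prod_j split_form j.
Proof.
move=> dq BM; rewrite /norm_form -det_map_mx.
set D := map_mx _ _.
pose C m n (A : 'M[L]_(m, n)) := map_mx (@mpolyC d L) A.
rewrite (@det_conj_diag _ _ _ D (C _ _ embmx) (C _ _ B) (\row_j split_form j)) //.
- by apply: eq_bigr => j _; rewrite mxE.
- by rewrite /C -map_mxM BM map_mx1.
apply/matrixP=> i' j; rewrite mul_mx_diag [LHS]mxE [RHS]mxE.
have DE l : D i' l = \sum_(i < d)
    'X_i * ((passmx.mxof e e (amulr e`_i) i' l)%:A : L)%:MP.
  rewrite mxE summxE rmorph_sum; apply: eq_bigr => i _.
  by rewrite mxE [map_mx _ _ _ _]mxE rmorphM /= map_mpolyX map_mpolyC.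
under eq_bigr => l _ do rewrite DE [C _ _ _ _ _]mxE mulr_suml.
rewrite exchange_big /= [C _ _ _ _ _]mxE [(\row__ _) _ _]mxE mulr_sumr.
apply: eq_bigr => i _; under eq_bigr => l _ do rewrite -mulrA -mpolyCM.
rewrite -mulr_sumr -raddf_sum mul_mxof_embmx /=.
by rewrite [embmx i j]mxE mpolyCM -mul_mpolyC mulrCA [X in _ * X]mulrC.
Qed.

End SplitNorm.

(** * Descent and congruences modulo a principal ideal *)

Section Retraction.

Variables (k : fieldType) (L : fieldExtType k).

(** A k-linear projection of L onto k. *)
Definition retract : {linear L -> k^o} := coord [tuple (1 : L)] ord0.

Lemma retract_alg a : retract a%:A = a.
Proof.
rewrite linearZ /=.
have free1 : free [tuple (1 : L)] by rewrite seq1_free oner_eq0.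
by have := coord_free ord0 ord0 free1; rewrite /= => ->; apply: mulr1.
Qed.

Lemma map_retract_mul n (c : {mpoly L[n]}) (f : {mpoly k[n]}) :
  map_mpoly retract (c * map_mpoly (in_alg L) f) = map_mpoly retract c * f.
Proof.
apply/mpolyP=> m; rewrite mcoeff_map_mpoly !mcoeffM raddf_sum /=.
apply: eq_bigr => i _; rewrite !mcoeff_map_mpoly /=.
by rewrite mulrC mulr_algl linearZ /= [RHS]mulrC.
Qed.

Lemma map_retractK n (f : {mpoly k[n]}) :
  map_mpoly retract (map_mpoly (in_alg L) f) = f.
Proof. by apply/mpolyP=> m; rewrite !mcoeff_map_mpoly /= retract_alg. Qed.

(** Divisibility descends along L / k: apply [retract] to the coefficients of the
    quotient. *)
Lemma principal_descent n (p f : {mpoly k[n]}) (c : {mpoly L[n]}) :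
  map_mpoly (in_alg L) p = c * map_mpoly (in_alg L) f -> exists q, p = q * f.
Proof.
move=> pE; exists (map_mpoly retract c).
by rewrite -map_retract_mul -pE map_retractK.
Qed.

End Retraction.

Section Congruence.

Variables (R : comNzRingType) (f : R).

Definition eqmod (a b : R) := exists c, a - b = c * f.

Lemma eqmod_refl a : eqmod a a.
Proof. by exists 0; rewrite subrr mul0r. Qed.

Lemma eqmod_sym a b : eqmod a b -> eqmod b a.
Proof. by move=> [c E]; exists (- c); rewrite mulNr -E opprB. Qed.

Lemma eqmod_trans b a c : eqmod a b -> eqmod b c -> eqmod a c.
Proof.
by move=> [u E] [v F]; exists (u + v); rewrite mulrDl -E -F addrA subrK.
Qed.

Lemma eqmodD a b c d : eqmod a b -> eqmod c d -> eqmod (a + c) (b + d).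
Proof.
by move=> [u E] [v F]; exists (u + v); rewrite mulrDl -E -F opprD addrACA.
Qed.

Lemma eqmodM a b c d : eqmod a b -> eqmod c d -> eqmod (a * c) (b * d).
Proof.
move=> [u E] [v F]; exists (u * c + b * v).
by rewrite mulrDl mulrAC -E -mulrA -F mulrBl mulrBr addrA subrK.
Qed.

Lemma eqmod_sum I (r : seq I) (a b : I -> R) :
  (forall i, eqmod (a i) (b i)) -> eqmod (\sum_(i <- r) a i) (\sum_(i <- r) b i).
Proof.
by move=> E; elim/big_rec2: _ => [|i x y _]; [apply: eqmod_refl|apply: eqmodD].
Qed.

Lemma eqmod_prod I (r : seq I) (a b : I -> R) :
  (forall i, eqmod (a i) (b i)) ->
  eqmod (\prod_(i <- r) a i) (\prod_(i <- r) b i).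
Proof.
by move=> E; elim/big_rec2: _ => [|i x y _]; [apply: eqmod_refl|apply: eqmodM].
Qed.

Lemma eqmodX a b n : eqmod a b -> eqmod (a ^+ n) (b ^+ n).
Proof.
move=> E; elim: n => [|n IHn]; first by rewrite !expr0; apply: eqmod_refl.
by rewrite !exprS; apply: eqmodM.
Qed.

Lemma eqmod_heval n (S : nzRingType) (u : S -> R) (a b : 'I_n -> R) g p :
  (forall i, eqmod (a i) (b i)) -> eqmod (heval u a g p) (heval u b g p).
Proof.
move=> E; apply: eqmod_sum => m.
apply: eqmodM; last exact: eqmod_refl.
apply: eqmodM; first exact: eqmod_refl.
by apply: eqmod_prod => i; apply: eqmodX.
Qed.

End Congruence.

(** * The ideal of the torus *)

Section TorusIdeal.

Variables (k : fieldType) (L : fieldExtType k) (K : falgType k).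
Local Notation d := (\dim {:K}).
Variables (n : nat) (sigma : 'I_(n + n) -> {linear K -> L}).
Hypothesis sigmaM : forall j x y, sigma j (x * y) = sigma j x * sigma j y.
Variable B : 'M[L]_(n + n, d).
Hypothesis dim_K : d = (n + n)%N.
Hypothesis B_inv : B *m embmx sigma = 1%:M.

Local Notation vz i := (lshift n i : 'I_(n + n)).
Local Notation vz' i := (rshift n i : 'I_(n + n)).

(** The torus over L is the hypersurface where the product of the coordinates S_i,
    S'_i is 1.  It is covered by the torus with coordinates z_i, z'_i, through
    S_i = z_i z'_i and S'_i = 1 / (z_i z'_(i-1)), indices modulo n.  The product
    of all the z_i and z'_i serves as a common denominator, and [cover_num j] is
    the numerator of the j-th coordinate.  The variables z_i come first. *)
Definition cover_den : {mpoly L[n + n]} := \prod_j 'X_j.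

Definition cover_num (j : 'I_(n + n)) : {mpoly L[n + n]} :=
  match split j with
  | inl i => 'X_(vz i) * 'X_(vz' i) * cover_den
  | inr i => \prod_(l | (l != vz i) && (l != vz' (ord_pred i))) 'X_l
  end.

Lemma cover_num_l i : cover_num (vz i) = 'X_(vz i) * 'X_(vz' i) * cover_den.
Proof. by rewrite /cover_num -[lshift n i]/(unsplit (inl i)) unsplitK. Qed.

Lemma cover_num_r i :
  cover_num (vz' i) * ('X_(vz i) * 'X_(vz' (ord_pred i))) = cover_den.
Proof.
rewrite /cover_num -[rshift n i]/(unsplit (inr i)) unsplitK /cover_den.
rewrite [RHS](bigD1 (vz i)) //= [in RHS](bigD1 (vz' (ord_pred i))) /=.
  by rewrite mulrC mulrA.
by rewrite eq_rlshift.
Qed.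

(** [B] goes back from the S_j to the coordinates on K. *)
Definition cover_coord (i : 'I_d) : {mpoly L[n + n]} :=
  \sum_j B j i *: cover_num j.

Definition cover_pullback (p : {mpoly k[d]}) : {mpoly L[n + n]} :=
  heval (@mpolyC (n + n) L \o in_alg L) cover_coord cover_den p.

Local Notation S j := (split_form sigma j).
Local Notation fL := (\prod_j S j - 1).
Local Notation "a === b" := (eqmod fL a b) (at level 70).

(** A section of the cover: z'_i = c_0 ... c_i and z_i = S_i c_(i+1) ... c_(n-1),
    which is S_i / z'_i as the product of all the c_i is 1. *)
Let c (i : 'I_n) := S (vz i) * S (vz' i).
Let zval (i : 'I_n) := S (vz i) * \prod_(j < n | (i < j)%N) c j.
Let zval' (i : 'I_n) := \prod_(j < n | (j <= i)%N) c j.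

Let prod_c : \prod_j c j === 1.
Proof.
exists 1; rewrite mul1r; congr (_ - _).
by rewrite big_split_ord /= -big_split.
Qed.

Let section_val (j : 'I_(n + n)) : {mpoly L[d]} :=
  match split j with inl i => zval i | inr i => zval' i end.

Let theta : {rmorphism {mpoly L[n + n]} -> {mpoly L[d]}} :=
  mmap (@mpolyC d L) section_val.

Let theta_X j : theta 'X_j = section_val j.
Proof. by rewrite -[LHS]/(mmap _ _ _) mmapX mmap1U. Qed.

Let section_l i : section_val (vz i) = zval i.
Proof. by rewrite /section_val -[lshift n i]/(unsplit (inl i)) unsplitK. Qed.

Let section_r i : section_val (vz' i) = zval' i.
Proof. by rewrite /section_val -[rshift n i]/(unsplit (inr i)) unsplitK. Qed.

Let zz' i : zval i * zval' i = S (vz i) * \prod_j c j.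
Proof.
rewrite -mulrA; congr (_ * _); rewrite [RHS](bigID (fun j : 'I_n => i < j)%N) /=.
by congr (_ * _); apply: eq_bigl => j; rewrite -leqNgt.
Qed.

Let zz'_pred i : S (vz' i) * (zval i * zval' (ord_pred i)) === 1.
Proof.
have -> : S (vz' i) * (zval i * zval' (ord_pred i))
    = c i * \prod_(j < n | (i < j)%N) c j * zval' (ord_pred i).
  by rewrite !mulrA; congr (_ * _ * _); rewrite mulrC.
have ci : c i * \prod_(j < n | (i < j)%N) c j = \prod_(j < n | (i <= j)%N) c j.
  rewrite [RHS](bigD1 i) //=; congr (_ * _); apply: eq_bigl => j.
  by rewrite ltn_neqAle andbC eq_sym.
rewrite ci /zval'; have [i0|i0] := posnP i.
  have -> : \prod_(j < n | (i <= j)%N) c j = \prod_j c j.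
    by apply: eq_bigl => j; rewrite i0.
  have -> : \prod_(j < n | (j <= ord_pred i)%N) c j = \prod_j c j.
    apply: eq_bigl => j; rewrite /= i0 add0n.
    have n0 : (0 < n)%N by apply: leq_ltn_trans (ltn_ord i).
    by rewrite modn_small ?prednK // -ltnS prednK // ltn_ord.
  by have := eqmodM prod_c prod_c; rewrite mulr1.
have -> : \prod_(j < n | (j <= ord_pred i)%N) c j = \prod_(j < n | (j < i)%N) c j.
  apply: eq_bigl => j /=.
  have -> : (i + n).-1 = (i.-1 + n)%N by case: (nat_of_ord i) i0.
  by rewrite modnDr modn_small ?(leq_ltn_trans (leq_pred _) (ltn_ord i)) // -ltnS prednK.
have := prod_c; rewrite (bigID (fun j : 'I_n => i <= j)%N) /=.
by under [X in _ * X]eq_bigl => j do rewrite -ltnNge.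
Qed.

Let theta_num j : theta (cover_num j) === theta cover_den * S j.
Proof.
case: (split_ordP j) => i ->.
  rewrite cover_num_l !rmorphM /= !theta_X section_l section_r zz' mulrC.
  apply: eqmodM; first exact: eqmod_refl.
  by rewrite -[X in _ === X]mulr1; apply: eqmodM prod_c; apply: eqmod_refl.
have <- := congr1 theta (cover_num_r i).
rewrite !rmorphM /= !theta_X section_l section_r -mulrA.
rewrite -[X in X === _]mulr1; apply: eqmodM; first exact: eqmod_refl.
by apply: eqmod_sym; rewrite mulrC; apply: zz'_pred.
Qed.

Let den_unit : theta cover_den * \prod_i S (vz' i) === 1.
Proof.
have -> : theta cover_den = (\prod_i zval i) * \prod_i zval' i.
  rewrite /cover_den rmorph_prod big_split_ord /=.
  by congr (_ * _); apply: eq_bigr => i _; rewrite theta_X ?section_l ?section_r.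
rewrite -!big_split /=.
apply: eqmod_trans prod_c; apply: eqmod_prod => i.
rewrite zz'; apply: eqmodM; last exact: eqmod_refl.
by rewrite -[X in _ === X]mulr1; apply: eqmodM prod_c; apply: eqmod_refl.
Qed.

(** Substituting the section into [cover_pullback p] gives back p, up to a factor
    which is invertible modulo N - 1. *)
Lemma cover_ideal p :
  cover_pullback p = 0 -> exists q, p = q * (norm_form K - 1).
Proof.
move=> /(congr1 theta); rewrite rmorph0 rmorph_heval => Q0.
pose pL := map_mpoly (in_alg L) p.
have SB i : \sum_j S j * (B j i)%:MP = 'X_i.
  have MB : embmx sigma *m B = 1%:M.
    move: (embmx sigma) (B) B_inv; rewrite dim_K => M B' BM.
    exact: mulmx1C.
  under eq_bigr => j _ do rewrite mulr_suml.
  rewrite exchange_big /= (bigD1 i) //= [X in _ + X]big1 ?addr0 => [|l li].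
    under eq_bigr => j _ do rewrite -scalerAl [_ * _%:MP]mulrC mul_mpolyC scalerA.
    rewrite -scaler_suml; have := congr1 (fun A : 'M_d => A i i) MB.
    by rewrite !mxE eqxx => ->; rewrite scale1r.
  under eq_bigr => j _ do rewrite -scalerAl [_ * _%:MP]mulrC mul_mpolyC scalerA.
  rewrite -scaler_suml; have := congr1 (fun A : 'M_d => A l i) MB.
  by rewrite !mxE (negPf li) => ->; rewrite scale0r.
have : theta cover_den ^+ msize p * pL === 0.
  apply: eqmod_sym; rewrite -[X in X === _]Q0.
  have -> : pL = mmap (theta \o (@mpolyC (n + n) L \o in_alg L)) (fun i => 'X_i) p.
    rewrite /pL rmorph_mpoly; apply: eq_bigr => m _; congr (_ * _).
      by rewrite /= map_mpolyC -[theta _]/(mmap _ _ _) mmapC.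
    by apply: mmap1_eq => i /=; rewrite map_mpolyX.
  rewrite -heval_scale; apply: eqmod_heval => i /=.
  rewrite /cover_coord rmorph_sum -SB mulr_sumr; apply: eqmod_sum => j.
  rewrite -mul_mpolyC rmorphM /= -[theta _%:MP]/(mmap _ _ _) mmapC /=.
  rewrite mulrC [X in eqmod _ _ X]mulrA.
  by apply: eqmodM; [apply: theta_num | apply: eqmod_refl].
move/(eqmodM (eqmod_refl fL ((\prod_i S (vz' i)) ^+ msize p))).
rewrite mulr0 mulrA -exprMn [_ * theta _]mulrC => p0.
have [q pE] : pL === 0.
  apply: eqmod_trans p0; apply: eqmod_sym.
  rewrite -[X in _ === X]mul1r; apply: eqmodM; last exact: eqmod_refl.
  by have := eqmodX (msize p) den_unit; rewrite expr1n.
apply: (@principal_descent _ L _ _ _ q).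
rewrite rmorphB rmorph1 /= (norm_form_split sigmaM dim_K B_inv).
by rewrite -pE subr0.
Qed.

End TorusIdeal.

(** * Polynomial maps into an extension field *)

Section PolynomialMaps.

Variables (k : fieldType) (L : fieldExtType k) (M : nat).
Implicit Types F G : ('I_M -> k) -> L.

Definition polymap F : Prop :=
  exists p : {mpoly L[M]}, forall w, F w = p.@[fun i => (w i)%:A].

Lemma polymap_cst c : polymap (fun=> c).
Proof. by exists c%:MP => w; rewrite mevalC. Qed.

Lemma polymap_var i : polymap (fun w => (w i)%:A).
Proof. by exists 'X_i => w; rewrite mevalXU. Qed.

Lemma polymapD F G : polymap F -> polymap G -> polymap (fun w => F w + G w).
Proof. by move=> [p pE] [q qE]; exists (p + q) => w; rewrite mevalD pE qE. Qed.

Lemma polymapN F : polymap F -> polymap (fun w => - F w).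
Proof. by move=> [p pE]; exists (- p) => w; rewrite mevalN pE. Qed.

Lemma polymapM F G : polymap F -> polymap G -> polymap (fun w => F w * G w).
Proof. by move=> [p pE] [q qE]; exists (p * q) => w; rewrite mevalM pE qE. Qed.

Lemma polymap_sum I (r : seq I) (P : pred I) (F : I -> ('I_M -> k) -> L) :
  (forall i, polymap (F i)) -> polymap (fun w => \sum_(i <- r | P i) F i w).
Proof.
move=> FP; elim: r => [|i r [p pE]].
  by exists 0 => w; rewrite big_nil meval0.
have [q qE] := FP i.
exists (if P i then q + p else p) => w; rewrite big_cons.
by case: (P i); rewrite ?mevalD ?qE -pE.
Qed.

Lemma polymap_prod I (r : seq I) (P : pred I) (F : I -> ('I_M -> k) -> L) :
  (forall i, polymap (F i)) -> polymap (fun w => \prod_(i <- r | P i) F i w).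
Proof.
move=> FP; elim: r => [|i r [p pE]].
  by exists 1 => w; rewrite big_nil meval1.
have [q qE] := FP i.
exists (if P i then q * p else p) => w; rewrite big_cons.
by case: (P i); rewrite ?mevalM ?qE -pE.
Qed.

Lemma meval_alg_monomial (w : 'I_M -> k) (m : 'X_{1..M}) :
  \prod_i (w i)%:A ^+ m i = (\prod_i w i ^+ m i)%:A :> L.
Proof.
rewrite -in_algE rmorph_prod; apply: eq_bigr => i _.
by rewrite rmorphXn.
Qed.

(** At k-points the monomials take values in k, so that a k-linear map can be
    applied to the coefficients. *)
Lemma meval_map_linear (V : comNzRingType) (f : {additive L -> V})
    (iota : k -> V) (p : {mpoly L[M]}) (w : 'I_M -> k) :
    (forall a x, f (a *: x) = f x * iota a) -> iota 1 = 1 ->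
    {morph iota : a b / a * b} ->
  (map_mpoly f p).@[iota \o w] = f p.@[fun i => (w i)%:A].
Proof.
move=> fZ iota1 iotaM; pose b := maxn (msize p) (msize (map_mpoly f p)).
rewrite /meval (mmapE b (leq_maxr _ _)) (mmapE b (leq_maxl _ _)).
rewrite raddf_sum; apply: eq_bigr => m _; rewrite mcoeff_map_mpoly /=.
rewrite {2}/mmap1 meval_alg_monomial mulr_algr fZ; congr (_ * _).
rewrite /mmap1 /= (big_morph iota iotaM iota1); apply: eq_bigr => i _.
by elim: (m i) => [|e IHe]; rewrite ?expr0 ?iota1 // !exprS iotaM IHe.
Qed.

Lemma polymap_linear (f : {linear L -> L}) F :
  polymap F -> polymap (fun w => f (F w)).
Proof.
move=> [p pE]; exists (map_mpoly f p) => w; rewrite pE.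
rewrite -(@meval_map_linear _ f (in_alg L)) //= => [a x||a b].
- by rewrite linearZ /= mulr_algr.
- exact: scale1r.
- exact: (rmorphM (in_alg L)).
Qed.

(** A polynomial map followed by a linear form is given by a polynomial over k. *)
Lemma polymap_functional (f : {linear L -> k^o}) F :
  polymap F -> exists q : {mpoly k[M]}, forall w, q.@[w] = f (F w).
Proof.
move=> [p pE]; exists (map_mpoly (f : {additive L -> k}) p) => w; rewrite pE.
rewrite -(@meval_map_linear _ (f : {additive L -> k}) idfun) //=.
by move=> a x; rewrite linearZ /= mulrC.
Qed.

End PolynomialMaps.

Lemma left_inverse_of_independent (F : fieldType) p q (A : 'M[F]_(p, q)) :
    (forall v : 'I_q -> F, (forall i, \sum_j v j * A i j = 0) ->
       forall j, v j = 0) ->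
  exists B, B *m A = 1%:M.
Proof.
move=> indep; apply/row_fullP; rewrite /row_full -mxrank_tr.
suff : row_free A^T by [].
apply: inj_row_free => v vA; apply/rowP=> j; rewrite mxE.
apply: (indep (v 0)) => i.
have /rowP/(_ i) := vA; rewrite !mxE => E.
by rewrite -[RHS]E; apply: eq_bigr => l _; rewrite mxE.
Qed.

Section Density.

Variables (k : fieldType) (L : fieldExtType k).
Hypothesis k_infinite : infinite_in (fun _ : k => True).

Lemma alg_infinite : infinite_in (fun x : L => exists a : k, x = a%:A).
Proof.
move=> N; have [r [ur Nr _]] := k_infinite N.
exists (map (in_alg L) r); split; last 1 first.
- by move=> x /mapP[a _ ->]; exists a.
- by rewrite map_inj_uniq //; apply: fmorph_inj.
- by rewrite size_map.
Qed.

Lemma eq0_at_base_points D (P : {mpoly L[D]}) :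
  (forall w : 'I_D -> k, P.@[fun i => (w i)%:A] = 0) -> P = 0.
Proof.
move=> P0; apply: (mpoly_eq0_infinite alg_infinite) => v vk.
pose w i := sval (constructive_indefinite_description _ (vk i)).
rewrite -[RHS](P0 w); apply: meval_eq => i; rewrite /w.
by case: constructive_indefinite_description.
Qed.

(** If the linear map A is onto, the image of the k-points is Zariski dense,
    although A has coefficients in L. *)
Lemma eq0_at_linear_image q D (A : 'M[L]_(D, q)) (C : 'M[L]_(q, D))
    (P : {mpoly L[q]}) :
    C *m A = 1%:M ->
    (forall w : 'I_D -> k, P.@[fun j => \sum_l (w l)%:A * A l j] = 0) ->
  P = 0.
Proof.
move=> CA P0.
have Linf : infinite_in (fun _ : L => True).
  by move=> N; have [r [ur Nr _]] := alg_infinite N; exists r.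
apply: (mpoly_eq0_infinite Linf) => v _.
pose Q : {mpoly L[D]} := mmap (@mpolyC D L) (fun j => \sum_l A l j *: 'X_l) P.
have QE w : Q.@[w] = P.@[fun j => \sum_l w l * A l j].
  rewrite [Q.@[w]]rmorph_sum; apply: eq_bigr => m _.
  rewrite rmorphM /= mevalC; congr (_ * _); rewrite rmorph_prod.
  apply: eq_bigr => j _; rewrite rmorphXn /= rmorph_sum; congr (_ ^+ _).
  by apply: eq_bigr => l _; rewrite /= mevalZ mevalXU mulrC.
have Q0 : Q = 0 by apply: eq0_at_base_points => w; rewrite QE.
have <- : Q.@[fun l => \sum_j v j * C j l] = P.@[v].
  rewrite QE; apply: meval_eq => j.
  under eq_bigr => l _ do rewrite mulr_suml.
  rewrite exchange_big /= (bigD1 j) //= [X in _ + X]big1 ?addr0 => [|i ij].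
    under eq_bigr => l _ do rewrite -mulrA.
    have /matrixP/(_ j j) := CA; rewrite -mulr_sumr !mxE eqxx => ->.
    by rewrite mulr1.
  under eq_bigr => l _ do rewrite -mulrA.
  have /matrixP/(_ i j) := CA; rewrite -mulr_sumr !mxE (negPf ij) => ->.
  by rewrite mulr0.
by rewrite Q0 meval0.
Qed.

End Density.

(** * The torus of a dihedral extension *)

Lemma mmap_alg (k : fieldType) (L : fieldExtType k) M (v : 'I_M -> k)
    (p : {mpoly k[M]}) :
  mmap (in_alg L) (fun i => (v i)%:A) p = (p.@[v])%:A.
Proof.
rewrite -[RHS]/((in_alg L \o meval v) p) [RHS]rmorph_mpoly; apply: eq_bigr => m _.
congr (_ * _); first by rewrite /= mevalC.
by apply: mmap1_eq => i /=; rewrite mevalXU.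
Qed.

Lemma meval_map_alg (k : fieldType) (L : fieldExtType k) M (v : 'I_M -> k)
    (p : {mpoly k[M]}) :
  (map_mpoly (in_alg L) p).@[fun i => (v i)%:A] = (p.@[v])%:A.
Proof.
rewrite -mmap_alg -[LHS]/((meval _ \o map_mpoly (in_alg L)) p) [LHS]rmorph_mpoly.
apply: eq_bigr => m _; congr (_ * _); first by rewrite /= map_mpolyC mevalC.
by apply: mmap1_eq => i /=; rewrite map_mpolyX mevalXU.
Qed.

Section DihedralTorus.

Variables (k : fieldType) (L : fieldExtType k) (E K1 K2 : {subfield L}).
(** On E, [R i] is the i-th power of the rotation rho = [R 1], [s] is a reflection,
    and [gam] and [gam'] are inverse to each other.  K1 is the fixed field of s,
    and [gam] maps K2 onto the fixed field of the reflection t = s rho. *)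
Variables (n : nat) (R : nat -> 'AEnd(L)) (s gam gam' : 'AEnd(L)).
Hypothesis n_gt0 : (0 < n)%N.
Hypothesis RE : forall i a, a \in E -> R i a \in E.
Hypothesis sE : forall a, a \in E -> s a \in E.
Hypothesis gam'E : forall a, a \in E -> gam' a \in E.
Hypothesis R0 : forall a, a \in E -> R 0 a = a.
Hypothesis RD : forall i j a, a \in E -> R i (R j a) = R (i + j) a.
Hypothesis Rn : forall a, a \in E -> R n a = a.
Hypothesis ss : forall a, a \in E -> s (s a) = a.
Hypothesis RsR : forall a, a \in E -> R 1 (s (R 1 a)) = s a.
Hypothesis gam'K : forall a, a \in E -> gam (gam' a) = a.
Hypothesis K1P : forall a, a \in K1 <-> a \in E /\ s a = a.
Hypothesis K2P : forall a, a \in K2 <-> a \in E /\ s (R 1 (gam a)) = gam a.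
Hypothesis dim_K1 : \dim K1 = n.
Hypothesis dim_K2 : \dim K2 = n.
Hypothesis independent : forall u v : 'I_n -> L,
  (forall a, a \in E -> \sum_i (u i * R i a + v i * R i (s a)) = 0) ->
  forall i, u i = 0 /\ v i = 0.
Hypothesis fixed_base : forall a, a \in E -> R 1 a = a -> s a = a -> a \in 1%VS.
Hypothesis k_infinite : infinite_in (fun _ : k => True).

Local Notation K := (subvs_of K1 * subvs_of K2)%type.
Local Notation d := (\dim {:K}).
Local Notation e := (vbasis {:K}).
Local Notation t a := (s (R 1 a)).

Let R_pred (i : 'I_n) a : a \in E -> R i (t a) = R (ord_pred i) (s a).
Proof.
move=> Ea.
have Rs j : R j.+1 (t a) = R j (s a).
  by rewrite -addn1 -RD ?RsR ?sE ?RE.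
have [i0|i0] := posnP i; last first.
  rewrite -(prednK i0) Rs /=; congr (R _ _).
  have -> : (i + n).-1 = (i.-1 + n)%N by case: (nat_of_ord i) i0.
  by rewrite modnDr modn_small ?(leq_ltn_trans (leq_pred _) (ltn_ord i)).
rewrite i0 /= i0 add0n modn_small ?prednK // -Rs prednK //.
by rewrite R0 ?Rn ?sE ?RE.
Qed.

Let t_t a : a \in E -> t (t a) = a.
Proof. by move=> Ea; rewrite RsR // ss. Qed.

(** The rotations, restricted to K1 for the first n indices, and composed with
    [gam] on K2 for the other ones. *)
Definition embedding (j : 'I_(n + n)) (x : K) : L :=
  match split j with
  | inl i => R i (vsval x.1)
  | inr i => R i (gam (vsval x.2))
  end.

Fact embedding_linear j : linear (embedding j).
Proof.
by move=> a x y; rewrite /embedding; case: (split j) => i; rewrite !linearP.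
Qed.

HB.instance Definition _ j :=
  GRing.isLinear.Build k K L *:%R (embedding j) (embedding_linear j).

Let sigma (j : 'I_(n + n)) : {linear K -> L} := embedding j.

Lemma embeddingM j x y : sigma j (x * y) = sigma j x * sigma j y.
Proof.
by rewrite /sigma /= /embedding; case: (split j) => i; rewrite /= !rmorphM.
Qed.

Lemma embedding_l i x : embedding (lshift n i) x = R i (vsval x.1).
Proof. by rewrite /embedding -[lshift n i]/(unsplit (inl i)) unsplitK. Qed.

Lemma embedding_r i x : embedding (rshift n i) x = R i (gam (vsval x.2)).
Proof. by rewrite /embedding -[rshift n i]/(unsplit (inr i)) unsplitK. Qed.

Lemma dim_K : d = (n + n)%N.
Proof. by rewrite dimvf /dim /= /dim /= dim_K1 dim_K2. Qed.

(** Independence of the embeddings of K1 follows from that of the automorphisms of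
    E: on the element a + s a of K1, a relation between the R i becomes a
    relation between the R i and the R i s.  Similarly for K2 with a + t a. *)
Lemma embmx_left_inverse : exists B : 'M[L]_(n + n, d), B *m embmx sigma = 1%:M.
Proof.
apply: left_inverse_of_independent => v v0.
have vK (x : K) : \sum_j v j * embedding j x = 0.
  rewrite (coord_vbasis (memvf x)).
  under eq_bigr => j _ do rewrite linear_sum mulr_sumr.
  rewrite exchange_big /= big1 // => i _.
  under eq_bigr => j _ do rewrite linearZ /= -scalerAr.
  rewrite -scaler_sumr; have := v0 i.
  by under eq_bigr => j _ do rewrite mxE; move=> ->; rewrite scaler0.
have v1 a : a \in E -> \sum_(i < n) v (lshift n i) * R i (a + s a) = 0.
  move=> Ea; have K1a : a + s a \in K1.
    by apply/K1P; rewrite rpredD ?sE // linearD /= ss // addrC.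
  have := vK (vsproj K1 (a + s a), 0); rewrite big_split_ord /=.
  rewrite [X in _ + X]big1 ?addr0 => [v0'|i _].
    rewrite -[RHS]v0'; apply: eq_bigr => i _.
    by rewrite embedding_l /= vsprojK.
  by rewrite embedding_r /= !linear0 mulr0.
have v2 a : a \in E -> \sum_(i < n) v (rshift n i) * R i (a + t a) = 0.
  move=> Ea; have K2a : gam' (a + t a) \in K2.
    apply/K2P; rewrite gam'E ?gam'K ?rpredD ?sE ?RE //; split=> //.
    by rewrite linearD /= linearD /= t_t // addrC.
  have := vK (0, vsproj K2 (gam' (a + t a))); rewrite big_split_ord /=.
  rewrite [X in X + _]big1 ?add0r => [v0'|i _].
    rewrite -[RHS]v0'; apply: eq_bigr => i _; rewrite embedding_r /= vsprojK // gam'K //.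
    by rewrite rpredD ?sE ?RE.
  by rewrite embedding_l /= !linear0 mulr0.
move=> j; case: (split_ordP j) => i ->.
  have [] // := @independent (fun i => v (lshift n i)) (fun i => v (lshift n i)) _ i.
  move=> a Ea; rewrite -[RHS](v1 a Ea); apply: eq_bigr => l _.
  by rewrite linearD mulrDr.
have [] // := @independent (fun i => v (rshift n i))
  (fun i => v (rshift n (ordS i))) _ i.
move=> a Ea; rewrite -[RHS](v2 a Ea) big_split /=.
under [RHS]eq_bigr => l _ do rewrite linearD /= mulrDr R_pred //.
rewrite big_split /=; congr (_ + _).
rewrite [RHS](reindex_inj (@ordS_inj n)).
apply: eq_bigr => l _; congr (_ * R _ _).
exact: (congr1 val (esym (ordSK l))).
Qed.

Let R_ordS (i : 'I_n) a : a \in E -> R 1 (R i a) = R (ordS i) a.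
Proof.
move=> Ea; rewrite RD // add1n /=.
have [ltin|] := ltnP i.+1 n; first by rewrite modn_small.
rewrite leq_eqVlt ltnNge ltn_ord orbF => /eqP <-.
by rewrite modnn R0 // Rn.
Qed.

Let R_fix f : f \in E -> R 1 f = f -> forall i, R i f = f.
Proof.
move=> Ef Rf; elim=> [|i IHi]; first exact: R0.
by rewrite -add1n -RD // IHi.
Qed.

Let RsR_iter i a : a \in E -> R i (s (R i a)) = s a.
Proof.
move=> Ea; elim: i => [|i IHi]; first by rewrite !R0 ?sE.
by rewrite -{1}addn1 -RD ?sE ?RE // -add1n -(RD 1 i) // RsR ?RE.
Qed.

Let s_R (i : 'I_n) a : a \in E -> s (R i a) = R 1 (R (rev_ord i) (s a)).
Proof.
move=> Ea; have Es : s (R i a) \in E by rewrite sE ?RE.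
rewrite -[in RHS](RsR_iter i Ea) !RD ?RE //=.
by rewrite add1n subnSK // subnK ?Rn // ltnW.
Qed.

Definition rot_trace a := \sum_(i < n) R i a.
Definition rot_norm a := \prod_(i < n) R i a.
Local Notation tr := rot_trace.
Local Notation nr := rot_norm.

Lemma rot_trace_fixed a : a \in E -> R 1 (tr a) = tr a.
Proof.
move=> Ea; rewrite linear_sum [RHS](reindex_inj (@ordS_inj n)).
by apply: eq_bigr => i _; apply: R_ordS.
Qed.

Lemma rot_norm_fixed a : a \in E -> R 1 (nr a) = nr a.
Proof.
move=> Ea; rewrite rmorph_prod [RHS](reindex_inj (@ordS_inj n)).
by apply: eq_bigr => i _; apply: R_ordS.
Qed.

Lemma rot_norm_s a : a \in E -> s (nr a) = nr (s a).
Proof.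
move=> Ea; rewrite -[RHS]rot_norm_fixed ?sE // !rmorph_prod.
rewrite [RHS](reindex_inj rev_ord_inj); apply: eq_bigr => i _.
exact: s_R.
Qed.

Lemma rot_traceE a : a \in E -> tr a \in E.
Proof. by move=> Ea; apply: rpred_sum => i _; apply: RE. Qed.

Lemma rot_normE a : a \in E -> nr a \in E.
Proof. by move=> Ea; apply: rpred_prod => i _; apply: RE. Qed.

Lemma rot_traceZ f a : f \in E -> R 1 f = f -> tr (f * a) = f * tr a.
Proof.
move=> Ef Rf; rewrite mulr_sumr; apply: eq_bigr => i _.
by rewrite rmorphM /= R_fix.
Qed.

(** The norm from E to k. *)
Definition full_norm a := nr a * nr (s a).
Local Notation Nm := full_norm.

Lemma full_norm_base a : a \in E -> exists c : k, Nm a = c%:A.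
Proof.
move=> Ea; apply/vlineP; apply: fixed_base.
- by rewrite rpredM ?rot_normE ?sE.
- by rewrite rmorphM /= !rot_norm_fixed ?sE.
- by rewrite rmorphM /= !rot_norm_s ?sE // ss // mulrC.
Qed.

Lemma full_norm_retract a : a \in E -> (retract L (Nm a))%:A = Nm a.
Proof. by move=> /full_norm_base[c ->]; rewrite retract_alg. Qed.

Lemma rot_norm_eq0 a : (nr a == 0) = (a == 0).
Proof.
apply/prodf_eq0/eqP => [[i _]|->]; first by rewrite fmorph_eq0 => /eqP.
by exists (Ordinal n_gt0); rewrite // rmorph0.
Qed.

Lemma full_norm_eq0 a : (Nm a == 0) = (a == 0).
Proof. by rewrite mulf_eq0 !rot_norm_eq0 fmorph_eq0 orbb. Qed.

Lemma exists_trace1 : exists2 theta, theta \in E & tr theta = 1.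
Proof.
have [[b Eb trb]|trb] := classic (exists2 b, b \in E & tr b != 0).
  have Etr := rot_traceE Eb.
  exists ((tr b)^-1 * b); first by rewrite rpredM // rpredV.
  by rewrite rot_traceZ ?rpredV ?mulVf // fmorphV /= rot_trace_fixed.
have [|/eqP] := @independent (fun=> 1) (fun=> 0) _ (Ordinal n_gt0).
  move=> a Ea; under eq_bigr => i _ do rewrite mul1r mul0r addr0.
  by apply/eqP; apply/idPn => tra; apply: trb; exists a.
by rewrite oner_eq0.
Qed.

(** The parametrization of the torus.  Here [yval] is the second coordinate after
    [gam]. *)
Definition xval (c : k) z := c^-1 *: (z * s z).
Definition yval (c : k) z := c%:A / (z * t z).

Definition point (c : k) z : K :=
  (vsproj K1 (xval c z), vsproj K2 (gam' (yval c z))).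

Lemma xvalE c z : z \in E -> xval c z \in E.
Proof. by move=> Ez; rewrite rpredZ // rpredM ?sE. Qed.

Lemma yvalE c z : z \in E -> yval c z \in E.
Proof. by move=> Ez; rewrite rpredM ?rpredV ?rpredM ?rpredZ ?mem1v ?sE ?RE. Qed.

Lemma point_x c z : z \in E -> vsval (point c z).1 = xval c z.
Proof.
move=> Ez; rewrite /point /= vsprojK //; apply/K1P; split; first exact: xvalE.
by rewrite linearZ /= rmorphM /= ss // mulrC.
Qed.

Lemma point_y c z : z \in E -> gam (vsval (point c z).2) = yval c z.
Proof.
move=> Ez; have Ey := yvalE c Ez.
rewrite /point /= vsprojK ?gam'K //; apply/K2P.
rewrite gam'E ?gam'K //; split=> //.
rewrite /yval !rmorphM !fmorphV !rmorphM /= t_t // !rmorph_alg.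
by rewrite [t z * z]mulrC.
Qed.

Lemma embedding_point_l c z i : z \in E ->
  embedding (lshift n i) (point c z) = c^-1 *: (R i z * R i (s z)).
Proof.
by move=> Ez; rewrite embedding_l point_x // linearZ /= rmorphM.
Qed.

Lemma embedding_point_r c z i : z \in E ->
  embedding (rshift n i) (point c z) = c%:A / (R i z * R (ord_pred i) (s z)).
Proof.
move=> Ez; rewrite embedding_r point_y // /yval rmorphM fmorphV rmorphM /=.
by rewrite R_pred // rmorph_alg.
Qed.

(** The factors from K1 and from K2 are R i z * R i (s z) / c and the inverse of
    R i z * R (i - 1) (s z) / c; they cancel after a shift of the indices. *)
Lemma prod_embedding_point c z : z \in E -> c != 0 -> z != 0 ->
  \prod_j embedding j (point c z) = 1.
Proof.
move=> Ez c0 z0; rewrite big_split_ord /=.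
under eq_bigr => i _ do rewrite embedding_point_l //.
under [X in _ * X]eq_bigr => i _ do rewrite embedding_point_r //.
rewrite -big_split /=.
have -> : \prod_(i < n) ((c^-1 *: (R i z * R i (s z))) *
      (c%:A / (R i z * R (ord_pred i) (s z))))
    = \prod_(i < n) (R i (s z) / R (ord_pred i) (s z)).
  apply: eq_bigr => i _; rewrite -scalerAl mulrCA mulr_algl scalerA mulVf //.
  by rewrite scale1r -mulf_div divff ?mul1r // fmorph_eq0.
rewrite big_split /= prodfV.
have -> : \prod_(i < n) R (ord_pred i) (s z) = \prod_(i < n) R i (s z).
  by rewrite [RHS](reindex_inj (@ord_pred_inj n)).
rewrite divff //; by apply/prodf_neq0 => i _; rewrite !fmorph_eq0.
Qed.

(** The fibres of the parametrization: z matters only up to a factor in the fixed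
    field of the rotations. *)
Lemma point_scale (a c : k) f z : f \in E -> R 1 f = f -> f != 0 ->
  f * s f = a%:A -> point (a * c) (f * z) = point c z.
Proof.
move=> Ef Rf f0 fa.
have a0 : a != 0.
  apply: contraNneq f0 => a0; have /eqP := fa.
  by rewrite a0 scale0r mulf_eq0 fmorph_eq0 orbb.
have xs : xval (a * c) (f * z) = xval c z.
  rewrite /xval rmorphM /= mulrACA fa mulr_algl scalerA invfM mulrAC.
  by rewrite mulVf // mul1r.
have ys : yval (a * c) (f * z) = yval c z.
  rewrite /yval !rmorphM /= Rf [f * z * _]mulrACA fa -[(a * c)%:A]in_algE rmorphM.
  by rewrite -mulf_div divff ?mul1r // fmorph_eq0.
by rewrite /point xs ys.
Qed.

Definition coords (x : K) (i : 'I_d) : k := coord e i x.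

Lemma embedding_coords j x :
  embedding j x = \sum_i (coords x i)%:A * embmx sigma i j.
Proof.
rewrite {1}(coord_vbasis (memvf x)) linear_sum; apply: eq_bigr => i _.
by rewrite linearZ /= mulr_algl mxE.
Qed.

Lemma split_form_coords j x :
  (split_form sigma j).@[fun i => (coords x i)%:A] = embedding j x.
Proof.
rewrite embedding_coords rmorph_sum; apply: eq_bigr => i _.
by rewrite /= mevalZ mevalXU mulrC.
Qed.

Lemma norm_form_coords x :
  ((norm_form K).@[coords x])%:A = \prod_j embedding j x :> L.
Proof.
have [B BM] := embmx_left_inverse.
rewrite -meval_map_alg (norm_form_split embeddingM dim_K BM) rmorph_prod.
by apply: eq_bigr => j _; apply: split_form_coords.
Qed.

Section Normalization.

Variable theta : L.
Hypotheses (Etheta : theta \in E) (tr_theta : tr theta = 1).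

(** A form on E which is linear over the fixed field of the rotations, and takes
    the value 1 at 1. *)
Definition slice_form z := tr (theta * z).

Fact slice_form_linear : linear slice_form.
Proof.
move=> a x y; rewrite /slice_form /rot_trace scaler_sumr -big_split.
by apply: eq_bigr => i _; rewrite mulrDr -scalerAr linearP.
Qed.

HB.instance Definition _ :=
  GRing.isLinear.Build k L L *:%R slice_form slice_form_linear.

Definition slice_space : {vspace L} := (E :&: lker (linfun slice_form))%VS.

Local Notation f := (vbasis slice_space).
Local Notation D := (\dim slice_space).

(** The coordinate of index 0 is left for c. *)
Definition slice_point (w : 'I_D.+1 -> k) : L :=
  1 + \sum_(j < D) w (lift ord0 j) *: f`_j.

Let slice_basis (j : 'I_D) : f`_j \in E /\ slice_form f`_j = 0.
Proof.
have /vbasis_mem : f`_j \in f by rewrite mem_nth // size_tuple.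
by rewrite memv_cap memv_ker lfunE /= => /andP[-> /eqP].
Qed.

Lemma slice_pointE w : slice_point w \in E.
Proof.
rewrite rpredD ?mem1v //; apply: rpred_sum => j _.
by rewrite rpredZ //; have [] := slice_basis j.
Qed.

Lemma slice_form_point w : slice_form (slice_point w) = 1.
Proof.
rewrite linearD linear_sum big1 /= => [|j _]; last first.
  by rewrite linearZ /=; have [_ ->] := slice_basis j; rewrite scaler0.
by rewrite addr0 /slice_form mulr1.
Qed.

Lemma slice_point_neq0 w : slice_point w != 0.
Proof.
apply/eqP=> z0; have /eqP := slice_form_point w.
by rewrite z0 linear0 eq_sym oner_eq0.
Qed.

Lemma slice_point_surj c z : z \in E -> slice_form z = 1 ->
  exists2 w, w ord0 = c & slice_point w = z.
Proof.
move=> Ez z1.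
have zW : z - 1 \in slice_space.
  rewrite memv_cap memv_ker lfunE /= linearB /= z1 rpredB ?mem1v //=.
  by rewrite /slice_form mulr1 tr_theta subrr.
exists (fun i => oapp (fun j => coord f j (z - 1)) c (unlift ord0 i)).
  by rewrite unlift_none.
rewrite /slice_point; under eq_bigr => j _ do rewrite liftK /=.
by rewrite -coord_vbasis // addrC subrK.
Qed.

(** The conjugates of z, as values of the variables z_i, z'_i of the cover. *)
Let zeta z (j : 'I_(n + n)) : L :=
  match split j with inl i => R i z | inr i => R i (s z) end.

Let zeta_l z i : zeta z (lshift n i) = R i z.
Proof. by rewrite /zeta -[lshift n i]/(unsplit (inl i)) unsplitK. Qed.

Let zeta_r z i : zeta z (rshift n i) = R i (s z).
Proof. by rewrite /zeta -[rshift n i]/(unsplit (inr i)) unsplitK. Qed.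

Let zeta_linear (I : finType) (c : I -> k) (b : I -> L) j :
  zeta (\sum_l c l *: b l) j = \sum_l (c l)%:A * zeta (b l) j.
Proof.
case: (split_ordP j) => i ->; rewrite ?zeta_l ?zeta_r !linear_sum /=;
  by apply: eq_bigr => l _; rewrite ?zeta_l ?zeta_r !linearZ /= mulr_algl.
Qed.

Let cover_num_zeta z j : z \in E -> z != 0 ->
  (cover_num L j).@[zeta z] = (cover_den L n).@[zeta z] * embedding j (point 1 z).
Proof.
move=> Ez z0; case: (split_ordP j) => i ->.
  rewrite cover_num_l !mevalM !mevalXU zeta_l zeta_r embedding_point_l //.
  by rewrite invr1 scale1r mulrC.
rewrite embedding_point_r // scale1r -(cover_num_r L i) !mevalM !mevalXU.
by rewrite zeta_l zeta_r mul1r mulfK // mulf_neq0 ?fmorph_eq0.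
Qed.

Let cover_pullback_zeta B z p : B *m embmx sigma = 1%:M ->
    z \in E -> z != 0 ->
  (cover_pullback B p).@[zeta z]
    = (cover_den L n).@[zeta z] ^+ msize p * (p.@[coords (point 1 z)])%:A.
Proof.
move=> BM Ez z0.
have MB : embmx sigma *m B = 1%:M.
  move: (embmx sigma) (B) BM; rewrite dim_K => M B' BM.
  exact: mulmx1C.
rewrite rmorph_heval -mmap_alg -heval_scale; apply: eq_heval => [c|i] /=.
  exact: mevalC.
rewrite rmorph_sum /=.
under eq_bigr => j _ do rewrite mevalZ cover_num_zeta // mulrCA embedding_coords.
rewrite -mulr_sumr; congr (_ * _).
under eq_bigr => j _ do rewrite mulr_sumr.
rewrite exchange_big /=.
under eq_bigr => l _ do under eq_bigr => j _ do rewrite mulrCA [B _ _ * _]mulrC.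
under eq_bigr => l _ do rewrite -mulr_sumr.
rewrite (bigD1 i) //= [X in _ + X]big1 ?addr0 => [|l li].
  by have /matrixP/(_ i i) := MB; rewrite !mxE eqxx => ->; rewrite mulr1.
by have /matrixP/(_ l i) := MB; rewrite !mxE (negPf li) => ->; rewrite mulr0.
Qed.

Let slice_poly : {mpoly L[n + n]} :=
  \sum_(i < n) R i theta *: 'X_(lshift n i).

Let slice_poly_zeta z : slice_poly.@[zeta z] = slice_form z.
Proof.
rewrite rmorph_sum; apply: eq_bigr => i _.
by rewrite /= mevalZ mevalXU zeta_l rmorphM.
Qed.

(** The conjugates of the elements of E being Zariski dense, it suffices that the
    pullback of p to the cover vanishes at the conjugates of those z for which
    [slice_form z] is not 0.  By [point_scale] the point of such a z, with c = 1,
    is also that of a normalized z. *)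
Lemma chart_ideal p :
    (forall w, w ord0 != 0 ->
       p.@[coords (point (w ord0) (slice_point w))] = 0) ->
  exists q, p = q * (norm_form K - 1).
Proof.
move=> p0; have [B BM] := embmx_left_inverse.
apply: (cover_ideal embeddingM dim_K BM).
have slice_poly0 : slice_poly != 0.
  apply/eqP=> sp0; have := slice_poly_zeta 1.
  rewrite sp0 meval0 /slice_form mulr1 tr_theta => /esym/eqP.
  by rewrite oner_eq0.
apply/eqP; rewrite -(inj_eq (mulfI slice_poly0)) mulr0; apply/eqP.
pose A : 'M[L]_(\dim E, n + n) := \matrix_(l, j) zeta (vbasis E)`_l j.
have [C CA] : exists C, C *m A = 1%:M.
  apply: left_inverse_of_independent => v v0 j.
  have vE a : a \in E ->
      \sum_i (v (lshift n i) * R i a + v (rshift n i) * R i (s a)) = 0.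
    move=> Ea; rewrite big_split.
    transitivity (\sum_j v j * zeta a j).
      rewrite big_split_ord /=; congr (_ + _);
        by apply: eq_bigr => i _; rewrite ?zeta_l ?zeta_r.
    rewrite (coord_vbasis Ea).
    under eq_bigr => i _ do rewrite zeta_linear mulr_sumr.
    rewrite exchange_big big1 //= => l _.
    under eq_bigr => i _ do rewrite mulrCA.
    rewrite -mulr_sumr; have := v0 l.
    by under eq_bigr => i _ do rewrite mxE; move=> ->; rewrite mulr0.
  by have vi := independent vE; case: (split_ordP j) => i ->; case: (vi i).
apply: (eq0_at_linear_image k_infinite CA) => w.
pose z := \sum_l w l *: (vbasis E)`_l.
have Ez : z \in E.
  apply: rpred_sum => l _; apply: rpredZ; apply: vbasis_mem.
  by rewrite mem_nth // size_tuple.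
rewrite (@meval_eq _ _ _ (zeta z)) => [|j]; last first.
  by rewrite zeta_linear; apply: eq_bigr => l _; rewrite mxE.
rewrite mevalM slice_poly_zeta.
have [->|fz0] := eqVneq (slice_form z) 0; first by rewrite mul0r.
have z0 : z != 0 by apply: contraNneq fz0 => ->; rewrite linear0.
rewrite cover_pullback_zeta //.
set fz := slice_form z in fz0 *.
have Ef : fz \in E by rewrite rot_traceE ?rpredM.
have Rf : R 1 fz = fz by rewrite rot_trace_fixed ?rpredM.
have Rs : R 1 (s fz) = s fz by rewrite -{1}Rf RsR.
have [a fa] : exists a : k, fz * s fz = a%:A.
  apply/vlineP; apply: fixed_base; rewrite ?rpredM ?sE //.
    by rewrite rmorphM /= Rf Rs.
  by rewrite rmorphM /= ss // mulrC.
have a0 : a != 0.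
  apply: contraNneq fz0 => a0; have /eqP := fa.
  by rewrite a0 scale0r mulf_eq0 fmorph_eq0 orbb.
have Efz : fz^-1 * z \in E by rewrite rpredM ?rpredV.
have [|w' w'0 w'z] := @slice_point_surj a^-1 (fz^-1 * z) Efz.
  rewrite /slice_form mulrCA rot_traceZ ?rpredV ?rpredM //.
    by rewrite mulVf.
  by rewrite fmorphV /= Rf.
have := p0 w'; rewrite w'0 w'z invr_eq0 => /(_ a0).
rewrite -(point_scale a^-1 (fz^-1 * z) Ef Rf fz0 fa).
by rewrite divff // mulVKf // => ->; rewrite scale0r !mulr0.
Qed.

Let o : 'I_n := Ordinal n_gt0.

(** The full norm of z divided by z t(z), by z, and by z s(z): these turn divisions
    by z into polynomials. *)
Let cof_zt z := (\prod_(i < n | i != o) R i z)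
  * \prod_(i < n | i != ord_pred o) R i (s z).
Let cof_z z := (\prod_(i < n | i != o) R i z) * nr (s z).
Let cof_zs z := (\prod_(i < n | i != o) R i z)
  * \prod_(i < n | i != o) R i (s z).

Let full_norm_zt z : z \in E -> Nm z = z * t z * cof_zt z.
Proof.
move=> Ez; rewrite /full_norm /rot_norm (bigD1 o) //=.
rewrite [X in _ * X](bigD1 (ord_pred o)) //= mulrACA; congr (_ * _ * _).
  exact: R0.
by rewrite -[LHS](R_pred o Ez) R0 // sE ?RE.
Qed.

Let full_norm_z z : z \in E -> Nm z = z * cof_z z.
Proof.
by move=> Ez; rewrite /full_norm {1}/rot_norm (bigD1 o) //= R0 // -mulrA.
Qed.

Let full_norm_zs z : z \in E -> Nm z = z * s z * cof_zs z.
Proof.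
move=> Ez; rewrite /full_norm /rot_norm (bigD1 o) //=.
by rewrite [X in _ * X](bigD1 o) //= mulrACA !R0 ?sE.
Qed.

(** The resolvent of Hilbert's Theorem 90 for x s(y). *)
Definition resolvent (x y : L) : L :=
  \sum_(i < n) (\prod_(j < i) R j (x * s y)) * R i theta.

(** With tau = [slice_form (resolvent x y)] one has z = resolvent / tau and
    c = z s(z) / x; the denominators x, tau and s(tau) divide the norm of
    x * tau. *)
Let scaled_x x y := x * slice_form (resolvent x y).
Let inv_den x y := Nm (scaled_x x y).
Let inv_z x y := resolvent x y * x * cof_z (scaled_x x y).
Let inv_c x y :=
  resolvent x y * s (resolvent x y) * s x * cof_zs (scaled_x x y).

Let xval_s_yval c z : z \in E -> c != 0 -> z != 0 ->
  xval c z * s (yval c z) = z / R 1 z.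
Proof.
move=> Ez c0 z0; rewrite /xval /yval rmorphM fmorphV rmorphM /= ss ?RE //.
rewrite rmorph_alg mulr_algl -scalerAl -scalerAr scalerA mulVf // scale1r.
by rewrite [s z * _]mulrC -mulf_div divff ?mulr1 // fmorph_eq0.
Qed.

Let prod_telescope z i : z \in E -> z != 0 ->
  \prod_(j < i) R j (z / R 1 z) = z / R i z.
Proof.
move=> Ez z0; elim: i => [|i IHi].
  by rewrite big_ord0 R0 // divff.
rewrite big_ord_recr /= IHi rmorphM fmorphV /= RD // addn1.
by rewrite mulrA divfK // fmorph_eq0.
Qed.

Lemma resolvent_point c z : z \in E -> c != 0 -> z != 0 ->
  resolvent (xval c z) (yval c z) = z * tr (theta / z).
Proof.
move=> Ez c0 z0; rewrite mulr_sumr; apply: eq_bigr => i _.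
rewrite xval_s_yval // prod_telescope // rmorphM fmorphV /=.
by rewrite -mulrA; congr (_ * _); rewrite mulrC.
Qed.

Let slice_resolvent c z : z \in E -> c != 0 -> slice_form z = 1 ->
  slice_form (resolvent (xval c z) (yval c z)) = tr (theta / z).
Proof.
move=> Ez c0 z1.
have z0 : z != 0.
  by apply: contra_eq_neq z1 => ->; rewrite linear0 eq_sym oner_eq0.
have Etz : theta / z \in E by rewrite rpredM ?rpredV.
rewrite resolvent_point // /slice_form [z * _]mulrC mulrCA.
rewrite rot_traceZ ?rot_traceE ?rot_trace_fixed //.
by rewrite -[tr (theta * z)]/(slice_form z) z1 mulr1.
Qed.

(** The inverse of the parametrization, with the norm of [scaled_x] as common
    denominator. *)
Let inverse_point c z : z \in E -> c != 0 -> slice_form z = 1 ->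
  let x := xval c z in let y := yval c z in
  inv_z x y = inv_den x y * z /\ inv_c x y = inv_den x y * c%:A.
Proof.
move=> Ez c0 z1 x y.
have z0 : z != 0.
  by apply: contra_eq_neq z1 => ->; rewrite linear0 eq_sym oner_eq0.
have Etz : theta / z \in E by rewrite rpredM ?rpredV.
have Ex : x \in E by apply: xvalE.
have Et : tr (theta / z) \in E by apply: rot_traceE.
have Eh : scaled_x x y \in E by rewrite rpredM // slice_resolvent.
split.
  rewrite /inv_z /inv_den full_norm_z // /scaled_x slice_resolvent //.
  by rewrite resolvent_point //; ring.
rewrite /inv_c /inv_den full_norm_zs // /scaled_x slice_resolvent //.
rewrite resolvent_point // !rmorphM /=.
have zsz : z * s z = x * c%:A.
  by rewrite mulr_algr scalerA mulfV // scale1r.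
set C := cof_zs _; set T := tr _.
transitivity ((z * s z) * (T * s T * s x * C)); first by ring.
by rewrite zsz; ring.
Qed.

Let fst_coord (i : 'I_d) (a : L) : k^o := coord e i ((vsproj K1 a, 0) : K).
Let snd_coord (i : 'I_d) (a : L) : k^o :=
  coord e i ((0, vsproj K2 (gam' a)) : K).

Fact fst_coord_linear i : linear (fst_coord i).
Proof.
move=> c a b; rewrite /fst_coord.
have -> : (vsproj K1 (c *: a + b), 0)
    = c *: ((vsproj K1 a, 0) : K) + (vsproj K1 b, 0).
  by rewrite linearP; congr pair; rewrite /= scaler0 addr0.
by rewrite linearP.
Qed.

Fact snd_coord_linear i : linear (snd_coord i).
Proof.
move=> c a b; rewrite /snd_coord.
have -> : (0, vsproj K2 (gam' (c *: a + b)))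
    = c *: ((0, vsproj K2 (gam' a)) : K) + (0, vsproj K2 (gam' b)).
  by rewrite !linearP; congr pair; rewrite /= scaler0 addr0.
by rewrite linearP.
Qed.

HB.instance Definition _ i :=
  GRing.isLinear.Build k L k^o *:%R (fst_coord i) (fst_coord_linear i).
HB.instance Definition _ i :=
  GRing.isLinear.Build k L k^o *:%R (snd_coord i) (snd_coord_linear i).

Let coords_point c z i :
  coords (point c z) i = fst_coord i (xval c z) + snd_coord i (yval c z).
Proof.
rewrite /coords /fst_coord /snd_coord.
have -> : point c z = ((vsproj K1 (xval c z), 0) : K)
    + (0, vsproj K2 (gam' (yval c z))).
  by congr pair; rewrite /= ?addr0 ?add0r.
by rewrite linearD.
Qed.

Let of_coords (v : 'I_d -> k) : K := \sum_i v i *: e`_i.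

Let of_coordsK x : of_coords (coords x) = x.
Proof. by rewrite [RHS](coord_vbasis (memvf x)). Qed.

Let x_of v := embedding (lshift n o) (of_coords v).
Let y_of v := embedding (rshift n o) (of_coords v).

Let x_of_point c z : z \in E -> x_of (coords (point c z)) = xval c z.
Proof.
by move=> Ez; rewrite /x_of of_coordsK embedding_point_l // !R0 ?sE.
Qed.

Let y_of_point c z : z \in E -> y_of (coords (point c z)) = yval c z.
Proof.
move=> Ez; rewrite /y_of of_coordsK embedding_point_r //.
by rewrite -(R_pred o Ez) !R0 ?sE ?RE.
Qed.

Let polymap_embedding j : polymap (fun v => embedding j (of_coords v)).
Proof.
have [q qE] : polymap (fun v : 'I_d -> k =>
    \sum_i (v i)%:A * embedding j (e`_i : K)).
  by apply: polymap_sum => i; apply: polymapM; [apply: polymap_var | apply: polymap_cst].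
exists q => v; rewrite -qE linear_sum; apply: eq_bigr => i _.
by rewrite linearZ /= mulr_algl.
Qed.

Let polymap_aut M (u : 'AEnd(L)) (F : ('I_M -> k) -> L) :
  polymap F -> polymap (fun w => u (F w)).
Proof. exact: (polymap_linear (u : {linear L -> L})). Qed.

Let polymap_slice M (F : ('I_M -> k) -> L) :
  polymap F -> polymap (fun w => slice_form (F w)).
Proof. exact: (polymap_linear slice_form). Qed.

Let polymap_rot_norm M (F : ('I_M -> k) -> L) :
  polymap F -> polymap (fun w => nr (F w)).
Proof. by move=> PF; apply: polymap_prod => i; apply: polymap_aut. Qed.

Let polymap_full_norm M (F : ('I_M -> k) -> L) :
  polymap F -> polymap (fun w => Nm (F w)).
Proof.
by move=> PF; apply: polymapM; apply: polymap_rot_norm => //; apply: polymap_aut.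
Qed.

Let polymap_cof_zt M (F : ('I_M -> k) -> L) :
  polymap F -> polymap (fun w => cof_zt (F w)).
Proof.
by move=> PF; apply: polymapM; apply: polymap_prod => i; do ?apply: polymap_aut.
Qed.

Let polymap_cof_zs M (F : ('I_M -> k) -> L) :
  polymap F -> polymap (fun w => cof_zs (F w)).
Proof.
by move=> PF; apply: polymapM; apply: polymap_prod => i; do ?apply: polymap_aut.
Qed.

Let polymap_cof_z M (F : ('I_M -> k) -> L) :
  polymap F -> polymap (fun w => cof_z (F w)).
Proof.
move=> PF; apply: polymapM; last by apply: polymap_rot_norm; apply: polymap_aut.
by apply: polymap_prod => i; do ?apply: polymap_aut.
Qed.

Let polymap_resolvent M (F G : ('I_M -> k) -> L) :
  polymap F -> polymap G -> polymap (fun w => resolvent (F w) (G w)).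
Proof.
move=> PF PG; apply: polymap_sum => i; apply: polymapM; last exact: polymap_cst.
apply: polymap_prod => j; apply: polymap_aut.
by apply: polymapM => //; apply: polymap_aut.
Qed.

Let polymap_slice_point : polymap slice_point.
Proof.
apply: polymapD; first exact: polymap_cst.
apply: polymap_sum => j.
have [q qE] := polymapM (polymap_var L (lift ord0 j)) (polymap_cst D.+1 f`_j).
by exists q => w; rewrite -qE mulr_algl.
Qed.

(** The numerators are [Nm z * (z * s z)] for x and [c ^+ 2 * cof_zt z] for y, over
    the common denominator [c * Nm z]. *)
Lemma birational_slice : birational (norm_one_torus K) 0 (Spec_base k) D.+1.
Proof.
have Px : polymap x_of by apply: polymap_embedding.
have Py : polymap y_of by apply: polymap_embedding.
have Pres := polymap_resolvent Px Py.
have PH : polymap (fun v => scaled_x (x_of v) (y_of v)).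
  by apply: polymapM => //; apply: polymap_slice.
have [h hE] := polymap_functional (retract L) (polymap_full_norm PH).
have Pc : polymap (fun v => inv_c (x_of v) (y_of v)).
  apply: polymapM (polymap_cof_zs PH); apply: polymapM; last exact: polymap_aut.
  by apply: polymapM => //; apply: polymap_aut.
have Pz : polymap (fun v => inv_z (x_of v) (y_of v) - inv_den (x_of v) (y_of v)).
  apply: polymapD; last exact: polymapN (polymap_full_norm PH).
  by apply: polymapM (polymap_cof_z PH); apply: polymapM.
have [eta_c eta_cE] := polymap_functional (retract L) Pc.
have etaP j : exists q : {mpoly k[d]}, forall v,
    q.@[v] = coord f j (inv_z (x_of v) (y_of v) - inv_den (x_of v) (y_of v)).
  exact: (polymap_functional (coord f j : {linear L -> k^o}) Pz).
have [eta etaE] := fin_all_exists etaP.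
pose w0 (w : 'I_D.+1 -> k) := w ord0.
have Pw0 : polymap (fun w => (w0 w)%:A : L) by apply: polymap_var.
have PN := polymap_full_norm polymap_slice_point.
have [g gE] := polymap_functional (retract L) (polymapM Pw0 PN).
have PX : polymap (fun w => Nm (slice_point w) * (slice_point w * s (slice_point w))).
  apply: polymapM => //; apply: polymapM (polymap_slice_point) _.
  exact: polymap_aut polymap_slice_point.
have PY : polymap (fun w => (w0 w)%:A * (w0 w)%:A * cof_zt (slice_point w)).
  by apply: polymapM (polymap_cof_zt polymap_slice_point); apply: polymapM.
have psiP i : exists q : {mpoly k[D.+1]}, forall w,
    q.@[w] = fst_coord i (Nm (slice_point w) * (slice_point w * s (slice_point w)))
      + snd_coord i ((w0 w)%:A * (w0 w)%:A * cof_zt (slice_point w)).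
  have [q1 q1E] := polymap_functional (fst_coord i) PX.
  have [q2 q2E] := polymap_functional (snd_coord i) PY.
  by exists (q1 + q2) => w; rewrite mevalD q1E q2E.
have [psi psiE] := fin_all_exists psiP.
have gA w : (g.@[w])%:A = (w0 w)%:A * Nm (slice_point w).
  rewrite gE; have [c ->] := full_norm_base (slice_pointE w).
  by rewrite -!in_algE -rmorphM /= retract_alg.
have g_neq0 w : (g.@[w] != 0) = (w0 w != 0).
  rewrite -[g.@[w] == 0](fmorph_eq0 (in_alg L)) /= gA mulf_eq0 full_norm_eq0.
  rewrite (negPf (slice_point_neq0 w)) orbF.
  by rewrite -[w0 w == 0](fmorph_eq0 (in_alg L)).
have chartE w : g.@[w] != 0 ->
    chart g psi w =1 coords (point (w0 w) (slice_point w)).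
  move=> gw i; have := gw; rewrite g_neq0 => w0w.
  have Ez := slice_pointE w; have z0 := slice_point_neq0 w.
  rewrite /chart psiE coords_point.
  have -> : Nm (slice_point w) * (slice_point w * s (slice_point w))
      = g.@[w] *: xval (w0 w) (slice_point w).
    rewrite -[g.@[w] *: _]mulr_algl gA /xval; move: (Nm _) (_ * s _) => A q.
    by rewrite -scalerAr -mulrA mulr_algl scalerA mulVf // scale1r.
  have -> : (w0 w)%:A * (w0 w)%:A * cof_zt (slice_point w)
      = g.@[w] *: yval (w0 w) (slice_point w).
    rewrite -[g.@[w] *: _]mulr_algl gA full_norm_zt // /yval.
    have : slice_point w * t (slice_point w) != 0 by rewrite mulf_neq0 ?fmorph_eq0.
    move: (_ * s _) (_%:A) (cof_zt _) => zt A C zt0.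
    by field.
  rewrite !linearZ /= -scalerDr; apply: (mulfI gw).
  by rewrite [LHS]mulrC divfK.
apply: (birational_of_points (g := g) (psi := psi) (h := h)
  (eta := fun j => oapp eta eta_c (unlift ord0 j))) => //.
- move=> p; split=> [[q ->] w gw|p0].
    rewrite mevalM mevalB meval1 (meval_eq _ (chartE w gw)).
    rewrite [X in _ * (X - 1)](meval_eq _ (chartE w gw)).
    suff -> : (norm_form K).@[coords (point (w0 w) (slice_point w))] = 1.
      by rewrite subrr mulr0.
    apply: (fmorph_inj (in_alg L)); rewrite /= norm_form_coords scale1r.
    by rewrite prod_embedding_point ?slice_pointE ?slice_point_neq0 -?g_neq0.
  apply: chart_ideal => w w0w; have gw : g.@[w] != 0 by rewrite g_neq0.
  by rewrite -(meval_eq _ (chartE w gw)) p0.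
- have [|w w1 wz] := @slice_point_surj 1 1 (mem1v _).
    by rewrite /slice_form mulr1.
  have gw : g.@[w] != 0 by rewrite g_neq0 /w0 w1 oner_eq0.
  exists w => //; rewrite (meval_eq _ (chartE w gw)) hE /w0 w1 wz.
  rewrite x_of_point ?y_of_point ?mem1v // /scaled_x slice_resolvent ?mem1v ?oner_eq0 //.
    rewrite divr1 tr_theta mulr1 /xval rmorph1 mulr1 invr1 scale1r.
    have -> : Nm 1 = 1%:A by rewrite scale1r /full_norm /rot_norm !(rmorph1, big1, mulr1) // => i _; rewrite !rmorph1.
    by rewrite retract_alg oner_eq0.
  by rewrite /slice_form mulr1.
move=> w j gw; have := gw; rewrite g_neq0 => w0w.
have Ez := slice_pointE w; have z1 := slice_form_point w.
rewrite !(meval_eq _ (chartE w gw)) hE.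
have [hz hc] := inverse_point Ez w0w z1.
have den : (retract L (inv_den (xval (w0 w) (slice_point w))
    (yval (w0 w) (slice_point w))))%:A = inv_den (xval (w0 w) (slice_point w))
    (yval (w0 w) (slice_point w)).
  apply: full_norm_retract; rewrite rpredM ?xvalE // slice_resolvent //.
  by rewrite rot_traceE // rpredM ?rpredV.
rewrite x_of_point // y_of_point //.
case: (unliftP ord0 j) => [i|] -> /=; last first.
  rewrite eta_cE x_of_point // y_of_point // hc -den -!in_algE -rmorphM /=.
  by rewrite !retract_alg.
rewrite etaE x_of_point // y_of_point // hz -den.
set nu := retract L _.
have -> : nu%:A * slice_point w - nu%:A
    = nu *: \sum_(i < D) w (lift ord0 i) *: f`_i.
  by rewrite mulr_algl -scalerBr /slice_point addrC addKr.
by rewrite linearZ /= coord_sum_free // (basis_free (vbasisP _)).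
Qed.

End Normalization.

Theorem norm_one_torus_dihedral_rational :
  exists N, birational (norm_one_torus K) 0 (Spec_base k) N.
Proof.
have [theta Etheta tr_theta] := exists_trace1.
by exists (\dim (slice_space theta)).+1; apply: birational_slice.
Qed.

End DihedralTorus.

(** * Stable rationality *)

Local Close Scope ring_scope.
Local Open Scope group_scope.

Theorem theorem1p8 (k : fieldType) (L : splittingFieldType k)
    (K1 K2 : {subfield L}) (m : nat)
    (sepK1 : separable 1 K1) (sepK2 : separable 1 K2)
    (m_ge1 : 1 <= m)
    (galK : galois 1 (K1 * K2))
    (dihK : 'Gal((K1 * K2) / 1) \isog 'D_(2 * (2 * m)))
    (degK1 : \dim_K1 (K1 * K2) = 2) (degK2 : \dim_K2 (K1 * K2) = 2)
    (ngalK1 : ~~ galois 1 K1) (ngalK2 : ~~ galois 1 K2)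
    (nconj : ~ exists2 s, s \in 'Gal({:L} / 1) & (s @: K1)%VS = K2) :
  stably_rational (norm_one_torus (subvs_of K1 * subvs_of K2)%type).
Proof.
set E : {subfield L} := (K1 * K2)%AS in galK dihK degK1 degK2 *.
have sK1E : (K1 <= E)%VS by apply: field_subvMr.
have sK2E : (K2 <= E)%VS by apply: field_subvMl.
have galK1 : galois K1 E by apply: galoisS galK; rewrite sub1v.
have galK2 : galois K2 E by apply: galoisS galK; rewrite sub1v.
have fixF (K : {subfield L}) : galois K E -> fixedField 'Gal(E / K) = K.
  by move/galois_fixedField.
have sub (K : {subfield L}) : 'Gal(E / K) \subset 'Gal(E / 1).
  exact: galS (sub1v _).
have oH1 : #|'Gal(E / K1)| = 2 by rewrite -galois_dim.
have oH2 : #|'Gal(E / K2)| = 2 by rewrite -galois_dim.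
have nH (K : {subfield L}) : galois K E -> ~~ galois 1 K ->
    ~~ ('Gal(E / K) <| 'Gal(E / 1)).
  move=> galKE; apply: contra => nK; have := normal_fixedField_galois galK nK.
  by rewrite (fixF _ galKE).
have nab : ~~ abelian 'Gal(E / 1).
  by apply: contra (nH _ galK1 ngalK1) => ab; rewrite -sub_abelian_normal ?sub.
(* a conjugation of the subgroups extends to an automorphism of L *)
have conjH g : g \in 'Gal(E / 1) -> 'Gal(E / K1) :^ g != 'Gal(E / K2).
  move=> Gg; apply/eqP; rewrite gal_conjg => eqG; apply: nconj.
  have Kg : (g @: K1)%VS = K2.
    have galg : galois (g @: K1)%AS E.
      apply: galoisS galK; rewrite sub1v /=.
      by have := limgS g sK1E; rewrite limg_gal.
    by rewrite -[RHS](fixF _ galK2) -eqG (fixF _ galg).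
  have kh : kHom 1 E g by rewrite -gal_kHom ?sub1v.
  have [|x Gx gx] := kHom_to_gal _ (normalFieldf 1) kh.
    by rewrite sub1v subvf.
  exists x => //; rewrite -Kg; apply: esym; apply: eq_in_limg => a K1a.
  by apply: gx; apply: (subvP sK1E).
have [s [t [c [[Gs Gt Gc] [H1s os] [H2t ot] or [sr genG]]]]] :=
  dihedral_reflections m_ge1 dihK (sub _) (sub _) oH1 oH2 (nH _ galK1 ngalK1)
    (nH _ galK2 ngalK2) conjH.
have s2 : s * s = 1 by rewrite -expg2 -os expg_order.
have t2 : t * t = 1 by rewrite -expg2 -ot expg_order.
have [tc tcE] : exists tc, tc = t ^ c by exists (t ^ c).
rewrite -tcE in or sr genG.
have tc2 : tc * tc = 1 by rewrite tcE -conjMg t2 conj1g.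
(* as automorphisms compose from left to right, rho is s after t ^ c *)
have [rho rhoE] : exists rho, rho = tc * s by exists (tc * s).
have rhoV : rho = (s * tc)^-1.
  apply: (mulIg (s * tc)); rewrite mulVg rhoE mulgA -[tc * s * s]mulgA s2.
  by rewrite mulg1.
have orho : #[rho] = (2 * m)%N by rewrite rhoV orderV.
have srho : s \notin <[rho]> by rewrite rhoV cycleV.
pose n := (2 * m)%N.
have n_gt0 : (0 < n)%N by rewrite muln_gt0.
have dimE : \dim E = (2 * n)%N.
  have := galois_dim galK; rewrite dimv1 divn1 => ->.
  rewrite (card_isog dihK) /n mul2n card_dihedral //.
  by rewrite mul2n -addnn (leq_add m_ge1 m_ge1).
have dimK (K : {subfield L}) : (K <= E)%VS -> \dim_K E = 2 -> \dim K = n.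
  move=> sKE dK; have := divnK (field_dimS sKE); rewrite dK dimE => /eqP.
  by rewrite eqn_pmul2l // => /eqP.
have mem_fix (K : {subfield L}) u a : galois K E -> 'Gal(E / K) = <[u]> ->
    #[u] = 2 -> a \in K <-> a \in E /\ u a = a.
  move=> gK Ku ou; have [sKE _ _] := and3P gK.
  split=> [Ka|[Ea ua]].
    have Ea := subvP sKE _ Ka; split=> //; apply: (fixed_gal sKE) Ka.
    by rewrite Ku cycle_id.
  rewrite -(fixF _ gK); apply/fixedFieldP => // x.
  by rewrite Ku cycle2g // !inE => /orP[] /eqP-> //; rewrite gal_id.
exists 0%N.
apply: (@norm_one_torus_dihedral_rational k L E K1 K2 n
  (fun i => gal_repr (rho ^+ i)) (gal_repr s) (gal_repr c) (gal_repr c^-1)) => //.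
- by move=> i a Ea; apply: (memv_gal (rho ^+ i) Ea).
- by move=> a Ea; apply: (memv_gal s Ea).
- by move=> a Ea; apply: (memv_gal c^-1 Ea).
- by move=> a Ea; rewrite expg0 gal_id.
- by move=> i j a Ea; rewrite -galM // -expgD addnC.
- by move=> a Ea; rewrite /n -orho expg_order gal_id.
- by move=> a Ea; rewrite -galM // s2 gal_id.
- move=> a Ea; rewrite -!galM ?memv_gal // expg1; congr (gal_repr _ _).
  by rewrite rhoE !mulgA -(mulgA tc s s) s2 mulg1 tc2 mul1g.
- by move=> a Ea; rewrite -galM // mulVg gal_id.
- by move=> a; apply: mem_fix.
- move=> a; rewrite (mem_fix _ t) //.
  have tE : a \in E -> s ((rho ^+ 1) (c a)) = c (t a).
    move=> Ea; rewrite -!galM ?memv_gal // expg1; congr (gal_repr _ _).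
    by rewrite rhoE -mulgA s2 mulg1 tcE -conjgC.
  split=> [[Ea ta]|[Ea tca]]; first by rewrite tE // ta.
  split=> //; rewrite tE // in tca.
  have := congr1 (gal_repr c^-1) tca.
  by rewrite -!galM ?memv_gal // mulgV mulg1 gal_id.
- exact: dimK.
- exact: dimK.
- move=> u v uv.
  pose w y := (\sum_(i < n | (rho ^+ i)%g == y) u i
    + \sum_(i < n | (s * rho ^+ i)%g == y) v i)%R.
  have expr_inj (i j : 'I_n) : (rho ^+ j == rho ^+ i) = (j == i).
    by rewrite eq_expg_mod_order orho !modn_small.
  have s_rot (i j : 'I_n) : (s * rho ^+ j == rho ^+ i) = false.
    apply: contraNF srho => /eqP sij.
    by rewrite -(mulgK (rho ^+ j) s) sij groupM ?groupV ?mem_cycle.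
  have w0 y : w y = 0%R.
    apply: (@gal_independent _ _ E predT w) => // a Ea; rewrite -[RHS](uv a Ea).
    rewrite [RHS]big_split /= [X in _ = (X + _)%R](partition_big (fun i : 'I_n => rho ^+ i) predT) //=.
    rewrite [X in _ = (_ + X)%R](partition_big (fun i : 'I_n => s * rho ^+ i) predT) //=.
    rewrite -big_split; apply: eq_bigr => x _; rewrite mulrDl !mulr_suml.
    congr (_ + _)%R; first by apply: eq_bigr => i /eqP->.
    by apply: eq_bigr => i /eqP <-; rewrite galM.
  move=> i; split.
    have := w0 (rho ^+ i); rewrite /w [X in (_ + X)%R]big_pred0; last exact: s_rot.
    by rewrite addr0 (big_pred1 i) // => j; apply: expr_inj.
  have := w0 (s * rho ^+ i); rewrite /w [X in (X + _)%R]big_pred0 => [|j].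
    by rewrite add0r (big_pred1 i) // => j; rewrite (inj_eq (mulgI s)); apply: expr_inj.
  by rewrite eq_sym; apply: s_rot.
- move=> a Ea; rewrite expg1 rhoE galM // => ra sa.
  have ta : tc a = a.
    have := congr1 (gal_repr s) ra.
    rewrite sa => sta; rewrite -[RHS]sta; have Eta : tc a \in E by apply: memv_gal.
    by rewrite -[RHS]galM // s2 gal_id.
  pose A : {set gal_of E} := [set s * tc; s].
  have Fa : a \in fixedField A.
    apply/fixedFieldP => // x /set2P[] -> //.
    by rewrite galM // sa ta.
  suff sF : (fixedField A <= 1)%VS by apply: (subvP sF).
  rewrite -[X in (_ <= X)%VS](fixF 1%AS galK).
  rewrite -(fixF _ (fixedField_galois A)) fixedFieldS //.
  by rewrite gal_generated.
exact: nonabelian_base_infinite nab.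
Qed.
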